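(* Let $J=\Delta+K$ be a Jacobi operator where $K$ is trace class. Then $C=C_{J\to\Delta}$ can be decomposed as $C=C_{\rm Toe}+C_{\rm com}$, where, for all $R>1$, $C_{\rm Toe}$ is upper triangular, Toeplitz and bounded as an operator from $\ell^1_R$ to $\ell^1_R$, and $C_{\rm com}$ is compact as an operator from $\ell^1_R$ to $\ell^1_R$. Also, if $J^{[m]}$ ($m\ge1$) are the Toeplitz-plus-finite-rank approximations of $J$, with connection coefficient matrices $C^{[m]}=C_{J^{[m]}\to\Delta}$ decomposed correspondingly as $C^{[m]}=C^{[m]}_{\rm Toe}+C^{[m]}_{\rm com}$, then $$C^{[m]}\to C,\qquad C^{[m]}_{\rm Toe}\to C_{\rm Toe},\qquad C^{[m]}_{\rm com}\to C_{\rm com}\qquad\text{as } m\to\infty$$ in the operator norm over $\ell^1_R$ for all $R>1$.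
   Context: All matrices are indexed from $0$. A Jacobi operator $J$ is a bounded self-adjoint operator on $\ell^2(\{0,1,2,\dots\})$ given by a symmetric tridiagonal matrix with real diagonal entries $J_{k,k}=\alpha_k$ and off-diagonal entries $J_{k,k+1}=J_{k+1,k}=\beta_k>0$. Its orthonormal polynomials are defined by $P_{-1}=0$, $P_0=1$, $sP_k(s)=\beta_{k-1}P_{k-1}(s)+\alpha_kP_k(s)+\beta_kP_{k+1}(s)$. The free Jacobi operator $\Delta$ has diagonal entries $0$ and off-diagonal entries $\tfrac12$; its orthonormal polynomials are the Chebyshev polynomials of the second kind $U_k$. The connection coefficient matrix $C_{J\to\Delta}=(c_{i,j})_{i,j\ge0}$ is the upper triangular matrix defined by $P_k=\sum_{i=0}^k c_{i,k}U_i$. That $K=J-\Delta$ is trace class means $\sum_{k\ge0}\left(|\alpha_k|+|\beta_k-\frac12|\right)<\infty$. The Toeplitz-plus-finite-rank approximation $J^{[m]}$ is the Jacobi operator with $J^{[m]}_{i,j}=J_{i,j}$ if $0\le i,j<m$ and $J^{[m]}_{i,j}=\Delta_{i,j}$ otherwise. For $R>0$, $\ell^1_R$ is the Banach space of scalar sequences $v$ with $\|v\|_{\ell^1_R}=\sum_{k\ge0}R^k|v_k|<\infty$. The Toeplitz part $C_{\rm Toe}$ is the upper triangular Toeplitz matrix with $(i,j)$ entry $t_{j-i}$ for $j\ge i$, where $t_k=\lim_{i\to\infty}c_{i,i+k}$ (existence of these limits is part of the assertion), and $C_{\rm com}=C-C_{\rm Toe}$; likewise for $C^{[m]}$. *)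

(* Defs.v *)
From HB Require Import structures.
From mathcomp Require Import all_boot all_order all_algebra.
From mathcomp Require Import all_classical all_reals all_analysis.
From mathcomp Require Import complex.

Set Implicit Arguments.
Unset Strict Implicit.
Unset Printing Implicit Defensive.

Import Order.TTheory GRing.Theory Num.Theory.
Import ComplexField.Normc numFieldNormedType.Exports.

Local Open Scope classical_set_scope.
Local Open Scope ring_scope.
Local Open Scope complex_scope.

(* Infinite matrices, indexed from 0, are functions of type nat -> nat -> R.
   Scalar sequences are complex. *)

Section Jacobi.
Context {R : realType}.
Implicit Types (J D c : nat -> nat -> R) (m n k i j : nat).

(* Row i of a tridiagonal matrix vanishes from column i + 2 on, hence the range
   of the inner sum. For real symmetric J, boundedness makes the operator
   self-adjoint. *)
Definition bounded_ell2 J : Prop :=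
  exists M : R, forall v : nat -> R[i],
    (\sum_(0 <= k <oo) (normc (v k) ^+ 2)%:E < +oo)%E ->
    (\sum_(0 <= i <oo)
        (normc (\sum_(j < i.+2) (J i j)%:C * v j)%R ^+ 2)%:E <=
     M%:E * \sum_(0 <= k <oo) (normc (v k) ^+ 2)%:E)%E.

Record jacobi J : Prop := Jacobi {
  jacobi_tridiagonal : forall i j, (i.+1 < j)%N || (j.+1 < i)%N -> J i j = 0;
  jacobi_symmetric : forall i j, J i j = J j i;
  jacobi_offdiag_gt0 : forall k, 0 < J k k.+1;
  jacobi_bounded : bounded_ell2 J }.

Definition free_jacobi i j : R :=
  if (j == i.+1) || (i == j.+1) then 2^-1 else 0.

(* For K = J - Delta. *)
Definition trace_class_perturbation J : Prop :=
  cvgn (series (fun k => `|J k k| + `|J k k.+1 - 2^-1|)).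

Definition finite_rank_approx m J i j : R :=
  if (i < m)%N && (j < m)%N then J i j else free_jacobi i j.

(* The pair (P_{n-1}, P_n); for n = 0 the coefficient J 0.-1 0 is irrelevant
   because it multiplies P_{-1} = 0. *)
Fixpoint orthopoly2 J n : {poly R} * {poly R} :=
  if n is k.+1 then
    let: (p, q) := orthopoly2 J k in
    (q, (J k k.+1)^-1 *: ('X * q - J k k *: q - J k.-1 k *: p))
  else (0, 1).

Definition orthopoly J n : {poly R} := (orthopoly2 J n).2.

Lemma orthopoly0 J : orthopoly J 0 = 1. Proof. by []. Qed.

Lemma orthopoly2E J n : (orthopoly2 J n.+1).1 = orthopoly J n.
Proof. by rewrite /orthopoly /=; case: (orthopoly2 J n). Qed.

Lemma orthopoly1 J : J 0%N 1%N != 0 ->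
  'X * orthopoly J 0 = J 0%N 0%N *: orthopoly J 0 + J 0%N 1%N *: orthopoly J 1.
Proof.
move=> J0; rewrite /orthopoly /= scaler0 subr0 scalerA divff// scale1r.
by rewrite addrC subrK.
Qed.

Lemma orthopolyS J k : J k.+1 k.+2 != 0 ->
  'X * orthopoly J k.+1 = J k k.+1 *: orthopoly J k
    + J k.+1 k.+1 *: orthopoly J k.+1 + J k.+1 k.+2 *: orthopoly J k.+2.
Proof.
move=> J0; rewrite [X in _ + _ *: X]/orthopoly.
have -> : (orthopoly2 J k.+2).2 = (J k.+1 k.+2)^-1 *:
    ('X * orthopoly J k.+1 - J k.+1 k.+1 *: orthopoly J k.+1
      - J k k.+1 *: orthopoly J k).
  have -> : orthopoly2 J k.+2 = let: (p, q) := orthopoly2 J k.+1 in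
      (q, (J k.+1 k.+2)^-1 *: ('X * q - J k.+1 k.+1 *: q - J k k.+1 *: p)).
    by [].
  rewrite [in LHS](surjective_pairing (orthopoly2 J k.+1)).
  by rewrite orthopoly2E.
rewrite scalerA divff// scale1r.
have E (a x y : {poly R}) : a = x + y + (a - y - x).
  by rewrite -[a - y - x]addrA -opprD [y + x]addrC [RHS]addrC subrK.
exact: E.
Qed.

Definition is_connection J D c : Prop :=
  (forall i j, (j < i)%N -> c i j = 0) /\
  (forall k, orthopoly J k = \sum_(i < k.+1) c i k *: orthopoly D i).

Definition connection J D : nat -> nat -> R :=
  xget (fun _ _ => 0) [set c | is_connection J D c].

Lemma size_orthopoly J n : (forall k, J k k.+1 != 0) ->
  size (orthopoly J n) = n.+1.
Proof.
move=> J0.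
suff : size (orthopoly J n) = n.+1 /\ size (orthopoly J n.+1) = n.+2 by case.
elim: n => [|n [IH0 IH1]].
  have -> : orthopoly J 1 = (J 0%N 1%N)^-1 *: ('X - (J 0%N 0%N)%:P).
    by rewrite /orthopoly /= scaler0 subr0 mulr1 alg_polyC.
  by rewrite size_scale ?invr_neq0// size_XsubC orthopoly0 size_poly1.
split=> //.
have Xn0 : orthopoly J n.+1 != 0 by rewrite -size_poly_gt0 IH1.
have := orthopolyS (J0 n.+1) => E.
rewrite -(size_scale _ (J0 n.+1)).
have -> : J n.+1 n.+2 *: orthopoly J n.+2 = 'X * orthopoly J n.+1
    - (J n n.+1 *: orthopoly J n + J n.+1 n.+1 *: orthopoly J n.+1).
  by rewrite E addrC addKr.
rewrite size_polyDl size_mul ?polyX_eq0// size_polyX IH1//= size_polyN.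
rewrite (leq_ltn_trans (size_polyD _ _))// gtn_max.
rewrite (leq_ltn_trans (size_scale_leq _ _)) ?IH0//=.
by rewrite (leq_ltn_trans (size_scale_leq _ _)) ?IH1.
Qed.

Lemma orthopoly_span D n (p : {poly R}) : (forall k, D k k.+1 != 0) ->
  (size p <= n)%N -> exists a : nat -> R, p = \sum_(i < n) a i *: orthopoly D i.
Proof.
move=> D0; elim: n p => [|n IH] p sp.
  by exists (fun=> 0); rewrite big_ord0; apply/eqP; rewrite -size_poly_leq0.
have Dn := size_orthopoly n D0.
have ln0 : (orthopoly D n)`_n != 0.
  have := @lead_coef_eq0 _ (orthopoly D n).
  by rewrite lead_coefE Dn/= => ->; rewrite -size_poly_eq0 Dn.
pose a := p`_n / (orthopoly D n)`_n.
have /IH[b bE] : (size (p - a *: orthopoly D n)%R <= n)%N.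
  apply/leq_sizeP => j; rewrite leq_eqVlt => /orP[/eqP<-|nj].
    by rewrite coefB coefZ divfK// subrr.
  by rewrite coefB coefZ !nth_default ?mulr0 ?subr0// ?Dn// (leq_trans sp).
exists (fun i => if i == n then a else b i).
rewrite big_ord_recr/= eqxx -[p in LHS](subrK (a *: orthopoly D n)) bE.
congr (_ + _); apply: eq_bigr => i _.
by rewrite ifF//; apply/negbTE; rewrite neq_ltn ltn_ord.
Qed.

Lemma connectionP J D : (forall k, J k k.+1 != 0) -> (forall k, D k k.+1 != 0) ->
  is_connection J D (connection J D).
Proof.
move=> J0 D0; rewrite /connection; case: xgetP => // /(_ _) noc.
have /choice[a aE] : forall k, exists a : nat -> R,
    orthopoly J k = \sum_(i < k.+1) a i *: orthopoly D i.
  by move=> k; apply: orthopoly_span => //; rewrite size_orthopoly.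
exfalso; apply: (noc (fun i j => if (i <= j)%N then a j i else 0)); split.
  by move=> i j ji; rewrite leqNgt ji.
by move=> k; rewrite aE; apply: eq_bigr => i _; rewrite -ltnS ltn_ord.
Qed.

Lemma is_connection_uniq J D c c' : (forall k, D k k.+1 != 0) ->
  is_connection J D c -> is_connection J D c' -> c = c'.
Proof.
move=> D0 [c0 cE] [c'0 c'E]; apply/funext => i; apply/funext => k.
have [ki|ik] := ltnP k i; first by rewrite c0// c'0.
have free n (a : nat -> R) : \sum_(i < n) a i *: orthopoly D i = 0 ->
    forall i, (i < n)%N -> a i = 0.
  elim: n => // n IH; rewrite big_ord_recr/= => s0.
  have an0 : a n = 0.
    apply/eqP; apply/negP => /negP an0.
    have : size (a n *: orthopoly D n) = n.+1.
      by rewrite size_scale// size_orthopoly.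
    move/eqP: s0; rewrite addrC addr_eq0 => /eqP ->; rewrite size_polyN => sn.
    suff : (n.+1 <= n)%N by rewrite ltnn.
    rewrite -[X in (X <= _)%N]sn (leq_trans (size_sum _ _ _))//.
    apply/bigmax_leqP => j _; rewrite (leq_trans (size_scale_leq _ _))//.
    by rewrite size_orthopoly.
  move: s0; rewrite an0 scale0r addr0 => /IH a0 j.
  by rewrite ltnS leq_eqVlt => /orP[/eqP->//|/a0].
apply/eqP; rewrite -subr_eq0; apply/eqP.
apply: (free k.+1 (fun i => c i k - c' i k)); last by rewrite ltnS.
under eq_bigr do rewrite scalerBl.
by rewrite sumrB -cE -c'E subrr.
Qed.

End Jacobi.

Section Toeplitz.
Context {R : realType}.
Implicit Types A : nat -> nat -> R.

Definition upper_triangular A : Prop := forall i j, (j < i)%N -> A i j = 0.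

Definition toeplitz A : Prop := forall i j, A i.+1 j.+1 = A i j.

Definition diag_limits_exist A : Prop :=
  forall k, cvgn (fun i => A i (i + k)%N).

Definition toeplitz_part A i j : R :=
  if (i <= j)%N then limn (fun l => A l (l + (j - i))%N) else 0.

Definition com_part A i j : R := A i j - toeplitz_part A i j.

End Toeplitz.

Section Ell1.
Context {R : realType} (rho : {posnum R}).

Definition ell1_summable (v : nat -> R[i]) : Prop :=
  cvgn (series (fun k => rho%:num ^+ k * normc (v k))).

Definition ell1_pred : {pred nat -> R[i]} := mem [set v | ell1_summable v].

Record ell1 := Ell1 { ell1_seq :> nat -> R[i]; _ : ell1_seq \in ell1_pred }.

HB.instance Definition _ := [isSub for ell1_seq].
HB.instance Definition _ := [Choice of ell1 by <:].

Lemma ell1_term_ge0 (v : nat -> R[i]) k : 0 <= rho%:num ^+ k * normc (v k).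
Proof.
by rewrite mulr_ge0 ?exprn_ge0//; case: (v k) => a b; exact: sqrtr_ge0.
Qed.

Lemma normcD_le (x y : R[i]) : normc (x + y) <= normc x + normc y.
Proof. exact: le_normcD. Qed.

Lemma ell1_termD (u v : nat -> R[i]) k : rho%:num ^+ k * normc ((u + v) k) <=
  rho%:num ^+ k * normc (u k) + rho%:num ^+ k * normc (v k).
Proof. by rewrite -mulrDr ler_wpM2l ?exprn_ge0// normcD_le. Qed.

Lemma ell1_termZ (a : R[i]) (v : nat -> R[i]) :
  (fun k => rho%:num ^+ k * normc ((a *: v) k)) =
  normc a *: (fun k => rho%:num ^+ k * normc (v k)).
Proof. by apply/funext => k /=; rewrite normcM mulrCA. Qed.

Lemma ell1_submod_closed : submod_closed ell1_pred.
Proof.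
split=> [|a u v].
  rewrite inE /= /ell1_summable (_ : (fun _ => _) = fun=> 0).
    by rewrite /series /=; under eq_fun do rewrite big1//; exact: is_cvg_cst.
  by apply/funext => k; rewrite normc0 mulr0.
rewrite !inE /= /ell1_summable => su sv.
have sau : cvgn (series (fun k => rho%:num ^+ k * normc ((a *: u) k))).
  by rewrite ell1_termZ; exact: is_cvg_seriesZ.
apply: (series_le_cvg _ _ (ell1_termD (a *: u) v)).
- by move=> k; exact: ell1_term_ge0.
- by move=> k; rewrite addr_ge0 ?ell1_term_ge0.
- exact: (is_cvg_seriesD sau sv).
Qed.

HB.instance Definition _ :=
  GRing.isSubmodClosed.Build R[i] (nat -> R[i]) ell1_pred ell1_submod_closed.
HB.instance Definition _ := [SubChoice_isSubLmodule of ell1 by <:].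

Definition ell1_norm (v : ell1) : R :=
  limn (series (fun k => rho%:num ^+ k * normc (v k))).

Lemma ell1P (v : ell1) : ell1_summable v.
Proof. by case: v => v /=; rewrite inE. Qed.

Lemma ell1_normD_real (u v : ell1) :
  ell1_norm (u + v) <= ell1_norm u + ell1_norm v.
Proof.
rewrite /ell1_norm -limD; [|exact: ell1P..].
apply: ler_lim; [exact: ell1P|by apply: is_cvgD; exact: ell1P|].
apply: nearW => n; rewrite -[leRHS]big_split/=.
by apply: ler_sum => k _; exact: ell1_termD.
Qed.

Lemma ell1_normZ_real a (v : ell1) :
  ell1_norm (a *: v) = normc a * ell1_norm v.
Proof.
by rewrite /ell1_norm [X in series X]ell1_termZ lim_seriesZ//; exact: ell1P.
Qed.

Lemma ell1_norm0_eq0 (v : ell1) : ell1_norm v = 0 -> v = 0.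
Proof.
move=> v0; apply/val_inj/funext => k /=; apply: eq0_normc.
have : rho%:num ^+ k * normc (v k) <= 0.
  rewrite -v0 (le_trans _ (nondecreasing_cvgn_le _ _ k.+1))//.
  - rewrite /series/= big_nat_recr//= lerDr.
    by apply: sumr_ge0 => i _; exact: ell1_term_ge0.
  - by apply: nondecreasing_series => i _ _; exact: ell1_term_ge0.
  - exact: ell1P.
move=> le0; have /eqP : rho%:num ^+ k * normc (v k) = 0.
  by apply: le_anti; rewrite le0 ell1_term_ge0.
by rewrite mulf_eq0 expf_eq0 gt_eqF// andbF => /eqP.
Qed.

(* MathComp norms take their values in the field of scalars, here R[i]. *)
Definition ell1_normC (v : ell1) : R[i] := (ell1_norm v)%:C.

Lemma ell1_normD u v : ell1_normC (u + v) <= ell1_normC u + ell1_normC v.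
Proof. by rewrite -rmorphD/= lecR ell1_normD_real. Qed.

Lemma ell1_normZ a v : ell1_normC (a *: v) = `|a| * ell1_normC v.
Proof. by rewrite /ell1_normC ell1_normZ_real rmorphM. Qed.

Lemma ell1_norm_eq0 v : ell1_normC v = 0 -> v = 0.
Proof. by case=> /ell1_norm0_eq0. Qed.

HB.instance Definition _ := Lmodule_isNormed.Build R[i] ell1
  ell1_normD ell1_normZ ell1_norm_eq0.

Lemma ell1_normE (v : ell1) : `|v| = (ell1_norm v)%:C.
Proof. by []. Qed.

Implicit Types (A : nat -> nat -> R) (S T : {linear ell1 -> ell1}).

(* (T v)_i = sum_j A_ij v_j, with convergent sums; ^o only selects the
   topology of R[i]. *)
Definition represents A T : Prop := forall (v : ell1) i,
  (series (fun j => (A i j)%:C * v j) : nat -> R[i]^o) @ \oo --> (T v i : R[i]^o).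

Definition opnorm (f : ell1 -> ell1) : \bar R :=
  ereal_sup [set (ell1_norm (f v))%:E | v in [set v | ell1_norm v <= 1]].

Definition compact_operator T : Prop :=
  forall B : set ell1, bounded_set B -> precompact (T @` B).

Definition mx_bounded A : Prop :=
  exists T, represents A T /\ (opnorm T < +oo)%E.

Definition mx_compact A : Prop :=
  exists T, represents A T /\ compact_operator T.

Definition mx_cvg_opnorm (A_ : nat -> nat -> nat -> R) A : Prop :=
  exists (T_ : nat -> {linear ell1 -> ell1}) (T : {linear ell1 -> ell1}),
  [/\ forall m, (0 < m)%N ->
        represents (A_ m) (T_ m) /\ (opnorm (T_ m) < +oo)%E,
      represents A T /\ (opnorm T < +oo)%E
    & opnorm (T_ m \- T) @[m --> \oo] --> 0%E].

End Ell1.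

(* Main.v *)
(** Read upwards from the diagonal, the columns z_k of the connection matrix
    satisfy z_{k+1} - z_k = S^2 (z_k - z_{k-1}) + (perturbation), where S is the
    shift and the perturbation is at most the sum of two consecutive terms of
    the trace norm times shifts of |z_k| and |z_{k-1}|, up to a constant.
    Weighted by q^j with q = 1/R < 1, S^2 contracts by
    q^2, so a discrete Gronwall argument makes the norms of the increments
    summable, with a majorant that serves J and all the J^[m] at once. Hence z_k
    converges to the Toeplitz symbol, at a rate given by the tail of the
    majorant. As the operator norm on l^1_R is the supremum of the weighted
    column norms, this bounds C_Toe; the columns of C_com tend to 0 in norm,
    which gives compactness; and since the columns of C^[m] and C agree up to m,
    all the differences are bounded by twice or four times the tail at m. *)

Require Import Defs.
From HB Require Import structures.
From mathcomp Require Import all_boot all_order all_algebra.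
From mathcomp Require Import all_classical all_reals all_analysis.
From mathcomp Require Import complex.
From mathcomp Require Import zify ring lra.

Set Implicit Arguments.
Unset Strict Implicit.
Unset Printing Implicit Defensive.

Import Order.TTheory GRing.Theory Num.Theory.
Import numFieldNormedType.Exports.

Local Open Scope classical_set_scope.
Local Open Scope ring_scope.

(** * Columns of the connection matrix from the three-term recurrence *)

Definition shift (V : nmodType) (x : nat -> V) j : V :=
  if j is k.+1 then x k else 0.

Section ConnectionColumns.
Context {R : realType}.
Implicit Types J : nat -> nat -> R.

(* Column [n.-1] of the connection matrix from [J] to the free operator; column
   [-1] is zero, like [P_{-1}]. *)
Fixpoint conn_col J n : nat -> R :=
  if n is m.+1 then
    if m is k.+1 then fun i => (J k k.+1)^-1 *
      (2^-1 * shift (conn_col J m) i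
       + 2^-1 * conn_col J m i.+1 - J k k * conn_col J m i
       - J k.-1 k * conn_col J k i)
    else fun i => (i == 0)%:R
  else fun=> 0.

Lemma conn_colSS J k i : conn_col J k.+2 i = (J k k.+1)^-1 *
  (2^-1 * shift (conn_col J k.+1) i
   + 2^-1 * conn_col J k.+1 i.+1 - J k k * conn_col J k.+1 i
   - J k.-1 k * conn_col J k i).
Proof. by []. Qed.

Lemma conn_col_eq0 J n i : (n <= i)%N -> conn_col J n i = 0.
Proof.
suff H : (forall i, (n <= i)%N -> conn_col J n i = 0) /\
         (forall i, (n < i)%N -> conn_col J n.+1 i = 0) by apply H.
elim: n {i} => [|n [IH0 IH1]]; first by split=> // -[].
split=> [i|[//|i] ni]; first exact: IH1.
by rewrite conn_colSS /shift !IH1 ?IH0 ?mulr0 ?addr0 ?subr0 ?mulr0//; lia.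
Qed.

Lemma free_jacobi_offdiag k : free_jacobi k k.+1 = 2^-1 :> R.
Proof. by rewrite /free_jacobi eqxx. Qed.

Lemma free_jacobi_diag k : free_jacobi k k = 0 :> R.
Proof. by rewrite /free_jacobi ltn_eqF. Qed.

Lemma free_jacobi_offdiag_neq0 k : free_jacobi k k.+1 != 0 :> R.
Proof. by rewrite free_jacobi_offdiag invr_eq0 pnatr_eq0. Qed.

Let U : nat -> {poly R} := orthopoly free_jacobi.

Lemma mulX_chebyshev i : 'X * U i =
  2^-1 *: shift U i + 2^-1 *: U i.+1.
Proof.
case: i => [|i].
  rewrite /U orthopoly1 ?free_jacobi_offdiag_neq0//.
  by rewrite free_jacobi_offdiag free_jacobi_diag scale0r scaler0.
rewrite /U orthopolyS ?free_jacobi_offdiag_neq0//.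
by rewrite !free_jacobi_offdiag free_jacobi_diag scale0r addr0.
Qed.

(** The Chebyshev recurrence is transposed onto the coefficients. The two vanishing conditions make
    the truncation exact: [a n = 0] removes the term in U_{n+1} on the left, [a n.+1 = 0] the last
    term on the right, which has no counterpart. *)
Lemma mulX_chebyshev_sum (a : nat -> R) n : a n = 0 -> a n.+1 = 0 ->
  'X * (\sum_(i < n.+1) a i *: U i) =
  \sum_(i < n.+1) (2^-1 * shift a i
                   + 2^-1 * a i.+1) *: U i.
Proof.
move=> an an1.
under [RHS]eq_bigr do rewrite scalerDl -!scalerA.
rewrite big_split/= mulr_sumr.
under [LHS]eq_bigr => i _ do rewrite -(scalerAr (a i)) mulX_chebyshev scalerDr.
rewrite big_split/= addrC; congr (_ + _).
  rewrite big_ord_recr/= an scale0r addr0 [RHS]big_ord_recl/= scale0r scaler0 add0r.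
  by apply: eq_bigr => i _; rewrite scalerA mulrC -scalerA.
rewrite big_ord_recl/= !scaler0 add0r [RHS]big_ord_recr/= an1 scale0r scaler0 addr0.
by apply: eq_bigr => i _; rewrite scalerA mulrC -scalerA.
Qed.

(** Both sides obey the recurrence of [J], whence a two-step induction. Every range [n > k] is
    allowed, the column being zero beyond [k], so that consecutive columns can be expanded over one
    common range. *)
Lemma orthopoly_conn_col J k n : (forall k, J k k.+1 != 0) -> (k < n)%N ->
  orthopoly J k = \sum_(i < n) conn_col J k.+1 i *: U i.
Proof.
move=> J0.
have J00 : forall n, (0 < n)%N ->
    orthopoly J 0 = \sum_(i < n) conn_col J 1 i *: U i.
  case=> // m _; rewrite big_ord_recl/= scale1r big1 ?addr0//.
  by move=> i _; rewrite scale0r.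
suff H : (forall n, (k < n)%N ->
     orthopoly J k = \sum_(i < n) conn_col J k.+1 i *: U i) /\
   (forall n, (k.+1 < n)%N ->
     orthopoly J k.+1 = \sum_(i < n) conn_col J k.+2 i *: U i) by apply H.
have step m (p : {poly R}) (k' : nat) : (m < k')%N ->
    orthopoly J m = \sum_(i < k'.+1) conn_col J m.+1 i *: U i ->
    p = \sum_(i < k'.+1) conn_col J m i *: U i ->
    (J m m.+1)^-1 *: ('X * orthopoly J m - J m m *: orthopoly J m
                      - J m.-1 m *: p) =
    \sum_(i < k'.+1) conn_col J m.+2 i *: U i.
  move=> mk Em Ep; rewrite {1}Em mulX_chebyshev_sum ?conn_col_eq0//; last lia.
  rewrite Em Ep !scaler_sumr -!sumrB scaler_sumr.
  apply: eq_bigr => i _.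
  by rewrite conn_colSS !scalerA -!scalerBl scalerA.
elim: k {n} => [|k [IH0 IH1]].
  split=> // -[//|n] n1.
  (* The polynomial P_{-1} = 0 is matched by the zero column [conn_col J 0]. *)
  rewrite -(step 0 0 n)//.
    exact: J00.
  by rewrite big1// => i _; rewrite scale0r.
split=> // -[//|n] kn; rewrite -(step k.+1 (orthopoly J k) n)//.
- apply: (scalerI (J0 k.+1)); rewrite scalerA divff// scale1r.
  have E (x y z : {poly R}) : z = x + y + z - y - x by ring.
  by rewrite orthopolyS//; exact: E.
- by apply: IH1; lia.
- by apply: IH0; lia.
Qed.

(** [connection] is picked by choice among the solutions of [is_connection]; uniqueness of the
    expansion in the U_i identifies it with the recursive columns. *)
Lemma connectionE J i k : (forall k, J k k.+1 != 0) ->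
  connection J free_jacobi i k = conn_col J k.+1 i.
Proof.
move=> J0; suff : is_connection J free_jacobi (fun i k => conn_col J k.+1 i).
  move/(is_connection_uniq free_jacobi_offdiag_neq0
    (connectionP J0 free_jacobi_offdiag_neq0)) => E.
  by rewrite -[conn_col _ _ _]/((fun i k => conn_col J k.+1 i) i k) -E.
split=> [a b ab|n]; first by rewrite conn_col_eq0.
exact: orthopoly_conn_col.
Qed.

End ConnectionColumns.

(** * Columns read from the diagonal and the recurrence of their increments *)

Section DiagonalColumns.
Context {R : realType}.
Implicit Types (J : nat -> nat -> R) (x : nat -> R) (q : R).

(** Estimates are made uniform in the truncation [n], so that finite sums stand in for the weighted
    l^1 norm. *)
Definition wsum q n x : R := \sum_(j < n) q ^+ j * x j.

Lemma wsum_ge0 q n x : 0 <= q -> (forall j, 0 <= x j) -> 0 <= wsum q n x.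
Proof. by move=> q0 x0; apply: sumr_ge0 => j _; rewrite mulr_ge0 ?exprn_ge0. Qed.

Lemma wsum_le q n x y : 0 <= q -> (forall j, x j <= y j) ->
  wsum q n x <= wsum q n y.
Proof. by move=> q0 xy; apply: ler_sum => j _; rewrite ler_wpM2l ?exprn_ge0. Qed.

Lemma wsumD q n x y : wsum q n (fun j => x j + y j) = wsum q n x + wsum q n y.
Proof. by rewrite -big_split; apply: eq_bigr => j _; rewrite mulrDr. Qed.

Lemma wsumZ q n a x : wsum q n (fun j => a * x j) = a * wsum q n x.
Proof. by rewrite mulr_sumr; apply: eq_bigr => j _; rewrite mulrCA. Qed.

Lemma wsum_shift q n x : 0 <= q -> (forall j, 0 <= x j) ->
  wsum q n (shift x) <= q * wsum q n x.
Proof.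
move=> q0 x0; case: n => [|n]; first by rewrite /wsum !big_ord0 mulr0.
rewrite {1}/wsum big_ord_recl/= mulr0 add0r /wsum big_ord_recr/= mulrDr mulr_sumr.
rewrite -[leLHS]addr0 lerD// ?mulr_ge0 ?exprn_ge0//.
by apply: ler_sum => j _; rewrite exprS mulrA.
Qed.

(* Column [n.-1] of the connection matrix read upwards from the diagonal, so
   that Toeplitz matrices have columns independent of [n]. *)
Definition diag_col J n j : R :=
  if (j < n)%N then conn_col J n (n.-1 - j) else 0.

(** Distances are measured from a diagonal that has moved down: in column [k.+1], the rows above, at
    and below row [k.+1 - j] lie at distances [j], [j - 1] and [j - 2]. At [j = k.+2] the left side
    is 0 while the right side may still see row 0 of the previous column, hence the bound on [j]. *)
Lemma diag_colSS J k j : (j < k.+2)%N -> diag_col J k.+2 j =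
  (J k k.+1)^-1 * (2^-1 * diag_col J k.+1 j
   + 2^-1 * shift (shift (diag_col J k.+1)) j
   - J k k * shift (diag_col J k.+1) j
   - J k.-1 k * shift (shift (diag_col J k)) j).
Proof.
move=> jk; rewrite {1}/diag_col jk conn_colSS; 
  congr (_ * (_ * _ + _ * _ - _ * _ - _ * _)).
- rewrite /diag_col; case: ltnP => jk1.
    by rewrite (_ : (k.+2.-1 - j = (k.+1.-1 - j).+1)%N)//=; lia.
  by rewrite (_ : (k.+2.-1 - j = 0)%N)//=; lia.
- case: j jk => [|[|j]] jk; rewrite [RHS]/=; [by rewrite conn_col_eq0//; lia..|].
  rewrite /diag_col ifT; [congr (conn_col _ _ _)|]; lia.
- case: j jk => [|j] jk; rewrite [RHS]/=; first by rewrite conn_col_eq0//; lia.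
  rewrite /diag_col ifT; [congr (conn_col _ _ _)|]; lia.
- case: j jk => [|[|j]] jk; rewrite [RHS]/=; [by rewrite conn_col_eq0//; lia..|].
  rewrite /diag_col ifT; [congr (conn_col _ _ _)|]; lia.
Qed.

Lemma shift_ge0 x j : (forall i, 0 <= x i) -> 0 <= shift x j.
Proof. by case: j => /=. Qed.

(** The recurrence divides by the off-diagonal entries, hence [B]. Both [B] and [del] are parameters
    so that one pair can serve an operator and all its approximations. *)
Definition perturbation_le (B : R) (del : nat -> R) J : Prop :=
  forall k, [/\ 0 < J k k.+1, (2 * J k k.+1)^-1 <= B
              & `|J k k| + `|J k k.+1 - 2^-1| <= del k].

Section Increment.
Context (B : R) (del : nat -> R) (J : nat -> nat -> R).
Hypothesis JP : perturbation_le B del J.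

Let z := diag_col J.
Let e k := 2 * B * (del k + del k.-1).

(** Up to sign, each coefficient is 2g times an entry of K or a difference of two: g - 1 = -2g
    (beta_k - 1/2), and 1 - 2 beta_{k-1} g = 2g ((beta_k - 1/2) - (beta_{k-1} - 1/2)). The factor
    [(k != 0)%:R] discards [J 0.-1 0], which is not an off-diagonal entry. *)
Lemma perturbation_coef_bounds k :
  let g := (2 * J k k.+1)^-1 in
  [/\ `|g - 1| <= e k, `|2 * g * J k k| <= e k
    & `|1 - 2 * J k.-1 k * g| * (k != 0)%:R <= e k].
Proof.
move=> g; have [b0 gB dk] := JP k; have [_ _ dk1] := JP k.-1.
have g0 : 0 < g by rewrite invr_gt0 mulr_gt0.
have gb : 2 * J k k.+1 * g = 1 by rewrite divff// gt_eqF ?mulr_gt0.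
have d0 : 0 <= del k by apply: le_trans dk; rewrite addr_ge0.
have d1 : 0 <= del k.-1 by apply: le_trans dk1; rewrite addr_ge0.
have small (x : R) : `|x| <= del k + del k.-1 -> `|2 * g * x| <= e k.
  have g2 : 0 <= 2 * g by rewrite mulr_ge0// ltW.
  by move=> xd; rewrite normrM ger0_norm// /e ler_pM// ler_wpM2l.
have nk := normr_ge0 (J k k); have nk1 := normr_ge0 (J k.-1 k.-1).
have no := normr_ge0 (J k k.+1 - 2^-1).
have E1 : g - 1 = - (2 * g * (J k k.+1 - 2^-1)).
  by rewrite -{1}gb; field.
split.
- by rewrite E1 normrN small//; lra.
- by apply: small; lra.
- have [k0|] := eqVneq k 0%N.
    by rewrite mulr0 (le_trans _ (small 0 _)) ?normr0// addr_ge0.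
  rewrite -lt0n mulr1 => k0; rewrite prednK// in dk1.
  have nk2 := normr_ge0 (J k.-1 k - 2^-1).
  have -> : 1 - 2 * J k.-1 k * g =
      2 * g * ((J k k.+1 - 2^-1) - (J k.-1 k - 2^-1)) by rewrite -{1}gb; ring.
  by apply: small; rewrite (le_trans (ler_normB _ _))// lerD//; lra.
Qed.

(* With the free operator the increments would simply move down by two places;
   the perturbation contributes a term that is summable in [k]. *)
Lemma diag_col_increment k j :
  `|z k.+2 j - z k.+1 j| <=
    shift (shift (fun i => `|z k.+1 i - z k i|)) j +
    e k * (`|z k.+1 j| + shift (fun i => `|z k.+1 i|) j
           + shift (shift (fun i => `|z k.+1 i|)) j
           + shift (shift (fun i => `|z k i|)) j).
Proof.
have [h1 h2 h3] := perturbation_coef_bounds k.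
have e0 : 0 <= e k := le_trans (normr_ge0 _) h1.
have [kj|jk] := leqP k.+2 j.
  rewrite /z /diag_col !ifF ?subr0 ?normr0; [|lia..].
  have S0 x : 0 <= shift (shift (fun i => `|x i|)) j.
    by apply: shift_ge0 => i; exact: shift_ge0.
  have S1 x : 0 <= shift (fun i => `|x i|) j by exact: shift_ge0.
  by rewrite addr_ge0// (mulr_ge0 e0)// !addr_ge0.
set g := (2 * J k k.+1)^-1 in h1 h2 h3.
(* Splitting off the free recurrence leaves terms whose coefficients are those of
   [perturbation_coef_bounds]. *)
have -> : z k.+2 j - z k.+1 j = shift (shift (fun i => z k.+1 i - z k i)) j
   + ((g - 1) * z k.+1 j - 2 * g * J k k * shift (z k.+1) j
      + (g - 1) * shift (shift (z k.+1)) j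
      + (1 - 2 * J k.-1 k * g) * (k != 0)%:R * shift (shift (z k)) j).
  rewrite /z diag_colSS//.
  have gE : (J k k.+1)^-1 = 2 * g by rewrite /g invfM mulrA divff// mul1r.
  (* The guard [(k != 0)%:R] can be inserted because [diag_col J 0] is zero. *)
  have E0 : (1 - 2 * J k.-1 k * g) * (k != 0)%:R * shift (shift (diag_col J k)) j
      = (1 - 2 * J k.-1 k * g) * shift (shift (diag_col J k)) j.
    case: (k) => [|k'] /=; last by rewrite mulr1.
    by case: (j) => [|[|j']]; rewrite /= !mulr0.
  rewrite E0 gE.
  have -> : shift (shift (fun i => diag_col J k.+1 i - diag_col J k i)) j =
      shift (shift (diag_col J k.+1)) j - shift (shift (diag_col J k)) j.
    by case: (j) => [|[|j']] //=; rewrite subr0.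
  by field.
rewrite (le_trans (ler_normD _ _))// lerD//.
  by case: (j) => [|[|j']] /=; rewrite ?normr0.
rewrite 3!mulrDr (le_trans (ler_normD _ _))// lerD//; last first.
  rewrite normrM normrM normr_nat.
  case: (j) => [|[|j']] /=; rewrite ?normr0 ?mulr0//.
  by rewrite ler_wpM2r.
rewrite (le_trans (ler_normD _ _))// lerD//; last first.
  rewrite normrM; case: (j) => [|[|j']] /=; rewrite ?normr0 ?mulr0//.
  by rewrite ler_wpM2r.
rewrite (le_trans (ler_normB _ _))// lerD//.
  by rewrite normrM ler_wpM2r.
by rewrite normrM; case: (j) => [|j'] /=; rewrite ?normr0 ?mulr0// ler_wpM2r.
Qed.

End Increment.

End DiagonalColumns.

(** * A discrete Gronwall inequality *)

Section Majorant.
Context {R : realType}.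
Implicit Types (e : nat -> R) (q : R).

(* The first component dominates the weighted norms of the increments in
   [diag_col_increment], the second one is the sum of the first ones so far,
   which dominates the columns themselves. *)
Fixpoint majorant q e k : R * R :=
  if k is l.+1 then
    let: (o, w) := majorant q e l in
    let o' := q ^+ 2 * o + 4 * e l * w in (o', w + o')
  else (1, 1).

Definition incr_bound q e k := (majorant q e k).1.

Lemma majorantS q e k : majorant q e k.+1 =
  let o := q ^+ 2 * incr_bound q e k + 4 * e k * (majorant q e k).2 in
  (o, (majorant q e k).2 + o).
Proof. by rewrite /incr_bound /=; case: (majorant q e k). Qed.

Lemma majorant_sum q e k : (majorant q e k).2 = series (incr_bound q e) k.+1.
Proof.
elim: k => [|k IH]; first by rewrite /series/= big_nat1.
by rewrite seriesSr -IH /incr_bound majorantS.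
Qed.

Lemma majorant_ge0 q e k : 0 <= q -> (forall k, 0 <= e k) ->
  0 <= incr_bound q e k /\ 0 <= (majorant q e k).2.
Proof.
move=> q0 e0; elim: k => [|k [IH1 IH2]]; first by [].
rewrite /incr_bound majorantS /=.
have h : 0 <= q ^+ 2 * incr_bound q e k + 4 * e k * (majorant q e k).2.
  by rewrite addr_ge0// mulr_ge0// ?exprn_ge0// mulr_ge0.
by split=> //; rewrite addr_ge0.
Qed.

(* With a = q^2 / (1 - q^2), the quantity (partial sum) + a (last term) grows at
   most by the factor 1 + 4 (1 + a) e k. *)
Lemma majorant_le q e k : 0 <= q < 1 -> (forall k, 0 <= e k) ->
  (majorant q e k).2 + q ^+ 2 / (1 - q ^+ 2) * incr_bound q e k <=
  expR (4 / (1 - q ^+ 2) * series e k) * (1 - q ^+ 2)^-1.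
Proof.
move=> /andP[q0 q1] e0.
have D0 : 0 < 1 - q ^+ 2 by rewrite subr_gt0 exprn_ilt1.
set D := 1 - q ^+ 2 in D0 *; have D0' := ltW D0.
have qD : q ^+ 2 = 1 - D by rewrite /D opprB addrC subrK.
elim: k => [|k IH].
  rewrite /series/= big_geq// mulr0 expR0 mul1r /incr_bound/= qD.
  by rewrite le_eqVlt; apply/orP; left; apply/eqP; field; rewrite gt_eqF.
have [og0 wg0] := majorant_ge0 k q0 e0.
rewrite seriesSr mulrDr expRD {1}majorantS {2}/incr_bound majorantS/=.
(* Here 1 + a = 1 / D, so one step multiplies by at most [1 + 4 / D * e k], which lies below its
   exponential. *)
rewrite [leRHS]mulrAC; apply: (@le_trans _ _ (
  ((majorant q e k).2 + q ^+ 2 / D * incr_bound q e k) * (1 + 4 / D * e k))).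
  move: (incr_bound q e k) (majorant q e k).2 og0 wg0 => o w og0 wg0; rewrite qD.
  rewrite -subr_ge0 [X in 0 <= X](_ : _ =
    (1 - D) * o * 4 * e k / D ^+ 2).
    by rewrite divr_ge0 ?exprn_ge0// -qD !mulr_ge0 ?exprn_ge0.
by field; rewrite gt_eqF.
apply: ler_pM => //.
- by rewrite addr_ge0// !mulr_ge0 ?exprn_ge0 ?invr_ge0.
- by rewrite addr_ge0// !mulr_ge0 ?invr_ge0.
- exact: expR_ge1Dx.
Qed.

(** The partial sums are nondecreasing, and [majorant_le] bounds them once [series e] is replaced by
    its limit inside the exponential. *)
Lemma cvg_incr_bound q e : 0 <= q < 1 -> (forall k, 0 <= e k) ->
  cvgn (series e) -> cvgn (series (incr_bound q e)).
Proof.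
move=> q01 e0 ce; have /andP[q0 q1] := q01.
have D0 : 0 < 1 - q ^+ 2 by rewrite subr_gt0 exprn_ilt1.
apply: nondecreasing_is_cvgn.
  by apply: nondecreasing_series => i _ _; have [] := majorant_ge0 i q0 e0.
exists (expR (4 / (1 - q ^+ 2) * limn (series e)) * (1 - q ^+ 2)^-1) => _ [[|k] _ <-].
  by rewrite /series/= big_geq// mulr_ge0 ?expR_ge0// invr_ge0 ltW.
rewrite -majorant_sum; have [og0 _] := majorant_ge0 k q0 e0.
apply: (@le_trans _ _ ((majorant q e k).2 + q ^+ 2 / (1 - q ^+ 2) * incr_bound q e k)).
  by rewrite lerDl !mulr_ge0 ?exprn_ge0 ?invr_ge0 ?(ltW D0).
rewrite (le_trans (majorant_le k q01 e0))// ler_pM2r ?invr_gt0// ler_expR.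
rewrite ler_pM2l ?divr_gt0//; apply: nondecreasing_cvgn_le ce _.
by apply: nondecreasing_series.
Qed.

End Majorant.

(** * Domination of the increments by the majorant *)

Section IncrementBound.
Context {R : realType} (B : R) (del : nat -> R) (q : R).
Hypothesis q01 : 0 <= q <= 1.
Let e k := 2 * B * (del k + del k.-1).

(** The induction also carries the norms of the two latest columns, since the perturbation involves
    both. As [q <= 1], shifts do not increase [wsum], so each of the four terms multiplied by [e k]
    is at most the second component of the majorant; this is the 4 in its recursion. *)
Lemma diag_col_increment_le J n k : perturbation_le B del J ->
  wsum q n (fun j => `|diag_col J k.+1 j - diag_col J k j|) <= incr_bound q e k.
Proof.
move=> JP; have /andP[q0 q1] := q01.
have e0 l : 0 <= e l.
  by have [h _ _] := perturbation_coef_bounds JP l; exact: le_trans h.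
pose z := diag_col J; rewrite -/z.
suff H : [/\ wsum q n (fun j => `|z k.+1 j - z k j|) <= incr_bound q e k,
    wsum q n (fun j => `|z k.+1 j|) <= (majorant q e k).2
  & wsum q n (fun j => `|z k j|) <= (majorant q e k).2] by have [] := H.
have triangle (x y : nat -> R) : wsum q n (fun j => `|x j|) <=
    wsum q n (fun j => `|y j|) + wsum q n (fun j => `|x j - y j|).
  rewrite -wsumD; apply: wsum_le => // j.
  by rewrite -{1}(subrK (y j) (x j)) addrC ler_normD.
have z0 m : wsum q m (fun j => `|z 0%N j|) = 0.
  by rewrite /wsum big1// => j _; rewrite /z /diag_col normr0 mulr0.
elim: k => [|k [IH1 IH2 IH3]].
  (* The starting pair [(1, 1)]: column 0 is zero and column 1 has the single entry 1. *)
  have h : wsum q n (fun j => `|z 1 j|) <= 1.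
    rewrite /wsum; case: (n) => [|m]; first by rewrite big_ord0.
    rewrite big_ord_recl /z /diag_col/= mul1r normr1 big1 ?addr0//.
    by move=> i _; rewrite normr0 mulr0.
  split=> //; last by rewrite z0.
  apply: le_trans h; apply: wsum_le => // j.
  by rewrite {2}/z /diag_col subr0.
have step : wsum q n (fun j => `|z k.+2 j - z k.+1 j|) <= incr_bound q e k.+1.
  apply: (le_trans (wsum_le _ q0 (diag_col_increment JP k))).
  have sh1 x : (forall j, 0 <= x j) -> wsum q n (shift x) <= wsum q n x.
    move=> x0; rewrite (le_trans (wsum_shift _ q0 x0))// ler_piMl//.
    exact: wsum_ge0.
  have sh2 x : (forall j, 0 <= x j) -> wsum q n (shift (shift x)) <= wsum q n x.
    by move=> x0; rewrite (le_trans (sh1 _ _)) ?sh1// => j; exact: shift_ge0.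
  rewrite wsumD wsumZ !wsumD {1}/incr_bound majorantS/= -/e.
  rewrite lerD//.
    rewrite (le_trans (wsum_shift _ q0 _))// => [j|]; first exact: shift_ge0.
    rewrite expr2 -mulrA ler_wpM2l// (le_trans (wsum_shift _ q0 _))//.
    by rewrite ler_wpM2l.
  rewrite -[2 * B * _]/(e k) -[leRHS]mulrA [leRHS]mulrCA ler_wpM2l//.
  have E4 (w : R) : 4 * w = w + w + w + w by ring.
  rewrite E4 !lerD//; [exact: le_trans (sh1 _ _) _|exact: le_trans (sh2 _ _) _..].
have [og0 wg0] := majorant_ge0 k.+1 q0 e0.
have wS : (majorant q e k.+1).2 = (majorant q e k).2 + incr_bound q e k.+1.
  by rewrite /incr_bound majorantS.
split=> //; last by rewrite wS (le_trans IH2)// lerDl.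
by rewrite wS (le_trans (triangle _ (z k.+1)))// lerD.
Qed.

End IncrementBound.

(** * Limits of columns with summable increments *)

Section SummableIncrements.
Context {R : realType}.
Implicit Types (om : nat -> R) (q : R) (z : nat -> nat -> R).

Definition series_tail om k : R := limn (series om) - series om k.

Lemma series_tail_ge om k l : (forall i, 0 <= om i) -> cvgn (series om) ->
  series om l - series om k <= series_tail om k.
Proof.
move=> om0 com; rewrite lerD2r; apply: nondecreasing_cvgn_le com _.
by apply: nondecreasing_series => i _ _; exact: om0.
Qed.

Lemma series_tail_ge0 om k : (forall i, 0 <= om i) -> cvgn (series om) ->
  0 <= series_tail om k.
Proof. by move=> h1 h2; have := series_tail_ge k k h1 h2; rewrite subrr. Qed.

Lemma series_tail_nonincreasing om k l : (forall i, 0 <= om i) -> (k <= l)%N ->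
  series_tail om l <= series_tail om k.
Proof.
move=> om0 kl; rewrite lerD2l lerN2.
by apply: nondecreasing_series => // i _ _; exact: om0.
Qed.

Lemma cvg_series_tail om : cvgn (series om) -> series_tail om @ \oo --> (0 : R).
Proof.
move=> com; rewrite -[X in _ --> X](subrr (limn (series om))).
by apply: cvgB com; exact: cvg_cst.
Qed.

Context (q : R) (om : nat -> R).
Hypotheses (q0 : 0 < q) (om0 : forall i, 0 <= om i) (com : cvgn (series om)).

Definition incr_le z := forall n k,
  wsum q n (fun j => `|z k.+1 j - z k j|) <= om k.

Lemma wsum_incr_le z n k l : incr_le z -> (k <= l)%N ->
  wsum q n (fun j => `|z l j - z k j|) <= series om l - series om k.
Proof.
move=> zP /subnK <-; elim: (l - k)%N => [|d IH].
  by rewrite subrr /wsum big1// => j _; rewrite subrr normr0 mulr0.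
rewrite addSn seriesSr addrAC; apply: (le_trans _ (lerD IH (zP n _))).
rewrite -wsumD; apply: wsum_le => [|j]; first exact: ltW.
by rewrite -[X in `|X|](subrKA (z (d + k)%N j)) addrC ler_normD.
Qed.

Lemma wsum_dist z n k l : incr_le z -> (k <= l)%N ->
  wsum q n (fun j => `|z l j - z k j|) <= series_tail om k.
Proof.
by move=> zP kl; rewrite (le_trans (wsum_incr_le n zP kl))// series_tail_ge.
Qed.

(** Coordinate [j] is a telescoping series; it converges absolutely because the term of index [j] in
    [wsum] controls its increments up to the positive weight [q ^+ j]. *)
Lemma cvg_diag z j : incr_le z -> cvgn (fun k => z k j).
Proof.
move=> zP; have -> : (fun k => z k j) =
    (fun k => z 0%N j + series (telescope (fun k => z k j)) k).
  by apply/funext => k; exact: eq_sum_telescope.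
apply: is_cvgD; first exact: is_cvg_cst.
apply: normed_cvg.
apply: (@series_le_cvg _ _ (fun k => (q ^+ j)^-1 * om k)) => [i|i|i|].
- exact: normr_ge0.
- by rewrite mulr_ge0// invr_ge0 exprn_ge0// ltW.
- rewrite /telescope -ler_pdivrMl ?invr_gt0 ?exprn_gt0// invrK.
  rewrite (le_trans _ (zP j.+1 i))// /wsum big_ord_recr/= lerDr.
  by apply: sumr_ge0 => l _; rewrite mulr_ge0// exprn_ge0// ltW.
- exact: is_cvg_seriesZ.
Qed.

Definition diag_lim z j : R := limn (fun k => z k j).

(** The bound of [wsum_dist] does not depend on [l], and in a finite sum the limit in [l] can be
    taken termwise. *)
Lemma wsum_diag_lim z n k : incr_le z ->
  wsum q n (fun j => `|z k j - diag_lim z j|) <= series_tail om k.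
Proof.
move=> zP.
have H : (fun l => wsum q n (fun j => `|z k j - z l j|)) @ \oo -->
    wsum q n (fun j => `|z k j - diag_lim z j|).
  apply: cvg_big => // [|j _].
    by move=> x; exact: add_continuous.
  apply: cvgM; first exact: cvg_cst.
  by apply: cvg_norm; apply: cvgB; [exact: cvg_cst|exact: cvg_diag].
rewrite -(cvg_lim _ H)//; apply: limr_le; first exact: cvgP H.
near=> l; under eq_fun do rewrite distrC.
by apply: wsum_dist => //; near: l; exact: nbhs_infty_ge.
Unshelve. all: end_near. Qed.

Let wsum_triangle n (x y w : nat -> R) :
  wsum q n (fun j => `|x j - w j|) <=
  wsum q n (fun j => `|x j - y j|) + wsum q n (fun j => `|y j - w j|).
Proof.
rewrite -wsumD; apply: wsum_le => [|j]; first exact: ltW.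
by rewrite -[X in `|X|](subrKA (y j)) ler_normD.
Qed.

(** Up to [m] the sequences coincide; beyond, each stays within the tail at [m] of the common column
    [z m], whence the factor 2. *)
Lemma wsum_dist_agree z z' m n k : incr_le z -> incr_le z' ->
  (forall k, (k <= m)%N -> z' k = z k) ->
  wsum q n (fun j => `|z' k j - z k j|) <= 2 * series_tail om m.
Proof.
move=> zP z'P zz'; have t0 := series_tail_ge0 m om0 com.
have [km|/ltnW mk] := leqP k m.
  rewrite zz'// /wsum big1 ?mulr_ge0// => j _.
  by rewrite subrr normr0 mulr0.
rewrite (le_trans (wsum_triangle n _ (z' m) _))// mulr_natl mulr2n lerD//.
  exact: wsum_dist.
rewrite zz'//; under eq_fun do rewrite distrC.
exact: wsum_dist.
Qed.

Lemma wsum_diag_lim_agree z z' m n : incr_le z -> incr_le z' ->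
  (forall k, (k <= m)%N -> z' k = z k) ->
  wsum q n (fun j => `|diag_lim z' j - diag_lim z j|) <= 2 * series_tail om m.
Proof.
move=> zP z'P zz'.
rewrite (le_trans (wsum_triangle n _ (z' m) _))// mulr_natl mulr2n lerD//.
  by under eq_fun do rewrite distrC; exact: wsum_diag_lim.
by rewrite zz'//; exact: wsum_diag_lim.
Qed.

End SummableIncrements.

(** * Weighted column norms of the connection matrix and its parts *)

Section ColumnNorms.
Context {R : realType}.
Implicit Types (A J : nat -> nat -> R) (b : nat -> R) (rho : R).

(** The j-th basis vector has norm [rho ^+ j], so [b j] bounds the factor by which the matrix
    stretches it. *)
Definition colnorm_le rho A b : Prop := upper_triangular A /\
  forall n j, \sum_(i < n) rho ^+ i * `|A i j| <= b j * rho ^+ j.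

(** Since rho^i = rho^j rho^-(j-i), reversing the order of the rows turns the column sum into
    [rho ^+ j] times a [wsum] with q = 1/rho. *)
Lemma colnorm_le_diag rho A (a : nat -> nat -> R) b : 0 < rho ->
  upper_triangular A -> (forall i j, (i <= j)%N -> A i j = a j (j - i)%N) ->
  (forall j, wsum rho^-1 j.+1 (fun d => `|a j d|) <= b j) ->
  colnorm_le rho A b.
Proof.
move=> rho0 Aut Aa ab; split=> // n j.
have rX k : 0 < rho ^+ k by exact: exprn_gt0.
apply: (@le_trans _ _ (\sum_(i < j.+1) rho ^+ i * `|A i j|)).
  have t0 (i : nat) : 0 <= rho ^+ i * `|A i j| by rewrite mulr_ge0// ltW.
  rewrite -!(big_mkord xpredT (fun i => rho ^+ i * `|A i j|)).
  have [nj|/ltnW jn] := leqP n j.+1.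
    by rewrite [leRHS](big_cat_nat (leq0n n) nj)/= lerDl sumr_ge0.
  rewrite [leLHS](big_cat_nat (leq0n j.+1) jn)/= [X in _ + X]big_nat_cond.
  rewrite [X in _ + X]big1 ?addr0// => i /andP[/andP[ji _] _].
  by rewrite Aut ?normr0 ?mulr0.
rewrite -ler_pdivrMr// (le_trans _ (ab j))// mulr_suml /wsum.
rewrite (reindex_inj rev_ord_inj)/=; apply: ler_sum => i _.
have ij : (i <= j)%N by rewrite -ltnS.
rewrite subSS Aa ?leq_subr// subKn// mulrAC ler_wpM2r// exprVn.
have -> : rho ^+ j = rho ^+ i * rho ^+ (j - i) by rewrite -exprD subnKC.
by rewrite invfM mulrCA divff ?mulr1// gt_eqF.
Qed.

Lemma connection_upper_triangular J : (forall k, 0 < J k k.+1) ->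
  upper_triangular (connection J free_jacobi).
Proof.
move=> J0 i j ji; rewrite connectionE => [|k]; last by rewrite gt_eqF.
by rewrite conn_col_eq0.
Qed.

Lemma toeplitz_part_upper_triangular A : upper_triangular (toeplitz_part A).
Proof. by move=> i j ji; rewrite /toeplitz_part leqNgt ji. Qed.

Lemma toeplitz_toeplitz_part A : toeplitz (toeplitz_part A).
Proof. by move=> i j; rewrite /toeplitz_part ltnS subSS. Qed.

Lemma com_part_upper_triangular A :
  upper_triangular A -> upper_triangular (com_part A).
Proof.
move=> Aut i j ji; rewrite /com_part Aut// toeplitz_part_upper_triangular//.
exact: subrr.
Qed.

Lemma connection_diag J i j : (forall k, 0 < J k k.+1) -> (i <= j)%N ->
  connection J free_jacobi i j = diag_col J j.+1 (j - i).
Proof.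
move=> J0 ij; rewrite connectionE => [|k]; last by rewrite gt_eqF.
by rewrite /diag_col ifT ?subKn//; lia.
Qed.

Lemma connection_diagE J d : (forall k, 0 < J k k.+1) ->
  (fun l => connection J free_jacobi l (l + d)%N) =
  (fun l => diag_col J (l + d.+1)%N d).
Proof.
move=> J0; apply/funext => l.
by rewrite connection_diag ?leq_addr// addKn addnS.
Qed.

Lemma toeplitz_part_diag J i j : (forall k, 0 < J k k.+1) ->
  cvgn (fun k => diag_col J k (j - i)%N) -> (i <= j)%N ->
  toeplitz_part (connection J free_jacobi) i j =
  diag_lim (diag_col J) (j - i)%N.
Proof.
move=> J0 cz ij; rewrite /toeplitz_part ij connection_diagE//.
by apply: cvg_lim => //; rewrite (cvg_shiftn _ (fun k => diag_col J k (j - i)%N)).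
Qed.

(** Summability forces beta_k to tend to 1/2, so (2 beta_k)^-1 converges and is bounded. The
    condition [1 <= B] lets the same [B] cover the free entries of the approximations, for which
    this quantity is 1. *)
Lemma perturbation_le_jacobi J : (forall k, 0 < J k k.+1) ->
  trace_class_perturbation J -> exists B, 1 <= B /\
  perturbation_le B (fun k => `|J k k| + `|J k k.+1 - 2^-1|) J.
Proof.
move=> J0 /cvg_series_cvg_0 d0.
have cJ : (fun k => J k k.+1) @ \oo --> (2^-1 : R).
  apply/subr_cvg0/norm_cvg0P.
  apply: (squeeze_cvgr _ (cvg_cst 0) d0); apply: nearW => k.
  by rewrite normr_ge0/= lerDr.
have /cvgP/cvg_seq_bounded[M [Mr /(_ (M + 1))]] :
    (fun k => (2 * J k k.+1)^-1) @ \oo --> (2 * 2^-1 : R)^-1.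
  by apply: cvgV; [rewrite divff ?oner_neq0|apply: cvgM cJ; exact: cvg_cst].
rewrite ltrDl => /(_ ltr01) bM.
exists (Num.max 1 (M + 1)); split=> [|k]; first by rewrite le_max lexx.
split=> //; rewrite le_max; apply/orP; right.
by apply: le_trans (bM k I); exact: ler_norm.
Qed.

Lemma perturbation_le_finite_rank_approx J B del m : 1 <= B ->
  perturbation_le B del J -> perturbation_le B del (finite_rank_approx m J).
Proof.
move=> B1 JP k; have [b0 bB dk] := JP k.
rewrite /finite_rank_approx free_jacobi_offdiag free_jacobi_diag.
have n1 := normr_ge0 (J k k); have n2 := normr_ge0 (J k k.+1 - 2^-1).
split; case: ifP => // _.
- by rewrite divff ?invr1.
- by case: ifP => // _; rewrite subrr normr0 addr0 (le_trans _ dk)// lerDl.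
- by case: ifP => _; rewrite ?subrr normr0 add0r (le_trans _ dk)// ?lerDr//.
Qed.

(** The polynomial P_{n-1} only involves entries of [J] with both indices below [n]. *)
Lemma conn_col_finite_rank_approx J m n : (n <= m)%N ->
  conn_col (finite_rank_approx m J) n = conn_col J n.
Proof.
suff H : ((n <= m)%N -> conn_col (finite_rank_approx m J) n = conn_col J n) /\
    ((n.+1 <= m)%N -> conn_col (finite_rank_approx m J) n.+1 = conn_col J n.+1).
  by case: H.
elim: n => [|n [IH0 IH1]]; first by [].
split=> // nm; apply/funext => i; rewrite !conn_colSS IH1 ?IH0; [|lia..].
by rewrite /finite_rank_approx !ifT//; lia.
Qed.

Lemma diag_col_finite_rank_approx J m n : (n <= m)%N ->
  diag_col (finite_rank_approx m J) n = diag_col J n.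
Proof.
by move=> nm; apply/funext => j; rewrite /diag_col conn_col_finite_rank_approx.
Qed.

Section Bounds.
Context (rho : R) (om : nat -> R).
Hypotheses (rho0 : 0 < rho) (om0 : forall i, 0 <= om i)
  (com : cvgn (series om)).
Let w := series_tail om.

Section OneMatrix.
Context (J : nat -> nat -> R).
Hypotheses (J0 : forall k, 0 < J k k.+1) (JP : incr_le rho^-1 om (diag_col J)).
Let C := connection J free_jacobi.

Let q0 : 0 < rho^-1. Proof. by rewrite invr_gt0. Qed.
Let cz j : cvgn (fun k => diag_col J k j) := cvg_diag q0 om0 com (j := j) JP.

Lemma diag_limits_exist_connection : diag_limits_exist C.
Proof.
move=> d; rewrite connection_diagE//.
have := @cz d; rewrite -(cvg_shiftn d.+1 (fun k => diag_col J k d)).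
exact: cvgP.
Qed.

(** As [diag_col J 0] is zero, the norm of a column is its distance from column 0, at most the total
    sum [w 0%N]. *)
Lemma colnorm_connection : colnorm_le rho C (fun=> w 0%N).
Proof.
apply: (colnorm_le_diag rho0 (connection_upper_triangular J0)
  (a := fun j => diag_col J j.+1)).
  by move=> i j ij; rewrite /C connection_diag.
move=> j; apply: (le_trans _ (wsum_dist q0 om0 com j.+1 JP (leq0n j.+1))).
apply: wsum_le => [|d]; first exact: ltW.
by rewrite (_ : diag_col J 0 d = 0)// subr0.
Qed.

Lemma colnorm_toeplitz_part : colnorm_le rho (toeplitz_part C) (fun=> w 0%N).
Proof.
apply: (colnorm_le_diag rho0 (@toeplitz_part_upper_triangular _)
  (a := fun=> diag_lim (diag_col J))).
  by move=> i j ij; rewrite /C toeplitz_part_diag.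
move=> j; apply: (le_trans _ (wsum_diag_lim q0 om0 com j.+1 0 JP)).
apply: wsum_le => [|d]; first exact: ltW.
by rewrite (_ : diag_col J 0 d = 0)// sub0r normrN.
Qed.

(** Column [j] is [diag_col J j.+1] minus its limit, hence the tail at [j.+1]; its decay is the
    source of compactness. *)
Lemma colnorm_com_part : colnorm_le rho (com_part C) (fun j => w j.+1).
Proof.
apply: (colnorm_le_diag rho0
  (com_part_upper_triangular (connection_upper_triangular J0))
  (a := fun j d => diag_col J j.+1 d - diag_lim (diag_col J) d)).
  by move=> i j ij; rewrite /C /com_part connection_diag// toeplitz_part_diag.
by move=> j; exact: wsum_diag_lim.
Qed.

End OneMatrix.

Section TwoMatrices.
Context (J J' : nat -> nat -> R) (m : nat).
Hypotheses (J0 : forall k, 0 < J k k.+1) (J'0 : forall k, 0 < J' k k.+1)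
  (JP : incr_le rho^-1 om (diag_col J)) (J'P : incr_le rho^-1 om (diag_col J'))
  (JJ' : forall k, (k <= m)%N -> diag_col J' k = diag_col J k).
Let C := connection J free_jacobi.
Let C' := connection J' free_jacobi.

Let q0 : 0 < rho^-1. Proof. by rewrite invr_gt0. Qed.

Let sub_upper A A' : upper_triangular A -> upper_triangular A' ->
  upper_triangular (fun i j => A' i j - A i j).
Proof. by move=> u u' i j ij; rewrite u// u'// subrr. Qed.

Lemma colnorm_connection_sub :
  colnorm_le rho (fun i j => C' i j - C i j) (fun=> 2 * w m).
Proof.
apply: (colnorm_le_diag rho0
  (sub_upper (connection_upper_triangular J0) (connection_upper_triangular J'0))
  (a := fun j d => diag_col J' j.+1 d - diag_col J j.+1 d)).
  by move=> i j ij; rewrite /C /C' !connection_diag.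
by move=> j; exact: wsum_dist_agree.
Qed.

Lemma colnorm_toeplitz_part_sub :
  colnorm_le rho (fun i j => toeplitz_part C' i j - toeplitz_part C i j)
    (fun=> 2 * w m).
Proof.
apply: (colnorm_le_diag rho0
  (sub_upper (@toeplitz_part_upper_triangular _)
    (@toeplitz_part_upper_triangular _))
  (a := fun j d => diag_lim (diag_col J') d - diag_lim (diag_col J) d)).
  move=> i j ij; rewrite /C /C' !toeplitz_part_diag//.
    exact: (cvg_diag q0 om0 com JP).
  exact: (cvg_diag q0 om0 com J'P).
by move=> j; exact: wsum_diag_lim_agree.
Qed.

Lemma colnorm_com_part_sub :
  colnorm_le rho (fun i j => com_part C' i j - com_part C i j)
    (fun=> 4 * w m).
Proof.
have [_ h1] := colnorm_connection_sub.
have [_ h2] := colnorm_toeplitz_part_sub.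
split.
  exact: sub_upper (com_part_upper_triangular (connection_upper_triangular J0))
    (com_part_upper_triangular (connection_upper_triangular J'0)).
move=> n j; have -> : 4 * w m * rho ^+ j =
  2 * w m * rho ^+ j + 2 * w m * rho ^+ j by ring.
rewrite (le_trans _ (lerD (h1 n j) (h2 n j)))// -big_split/=.
apply: ler_sum => i _; rewrite -mulrDr ler_wpM2l ?exprn_ge0 ?(ltW rho0)//.
have -> : com_part C' i j - com_part C i j = (C' i j - C i j)
    - (toeplitz_part C' i j - toeplitz_part C i j).
  by rewrite /com_part; ring.
exact: ler_normB.
Qed.

End TwoMatrices.

End Bounds.

End ColumnNorms.

(** * Complex convergence via modulus, real and imaginary parts *)

Section ComplexConvergence.
Context {R : realType}.
Local Open Scope complex_scope.
Import ComplexField.Normc.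
Local Notation Re := complex.Re.
Local Notation Im := complex.Im.

Lemma normc_ge0 (x : R[i]) : 0 <= normc x.
Proof. by case: x => a b; exact: sqrtr_ge0. Qed.

Lemma normc_real (x : R) : normc x%:C = `|x|.
Proof. by rewrite /normc /= expr0n addr0 sqrtr_sqr. Qed.

Lemma ler_Re_normc (x : R[i]) : `|Re x| <= normc x.
Proof.
case: x => a b /=; rewrite -sqrtr_sqr ler_sqrt ?addr_ge0 ?sqr_ge0//.
by rewrite lerDl sqr_ge0.
Qed.

Lemma ler_Im_normc (x : R[i]) : `|Im x| <= normc x.
Proof.
case: x => a b /=; rewrite -sqrtr_sqr ler_sqrt ?addr_ge0 ?sqr_ge0//.
by rewrite lerDr sqr_ge0.
Qed.

Lemma normc_le_ReIm (x : R[i]) : normc x <= `|Re x| + `|Im x|.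
Proof.
case: x => a b; rewrite -[leRHS]ger0_norm ?addr_ge0// -sqrtr_sqr ler_sqrt ?sqr_ge0//.
by rewrite sqrrD !real_normK ?num_real// lerD2r lerDl mulrn_wge0 ?mulr_ge0.
Qed.

Lemma ler_dist_normc (x y : R[i]) : `|normc x - normc y| <= normc (x - y).
Proof.
have H (u v : R[i]) : normc u - normc v <= normc (u - v).
  by rewrite lerBlDr -{1}(subrK v u) normcD_le.
by rewrite ler_norml H andbT lerNl opprB -[X in _ <= X]normcN opprB H.
Qed.

Lemma ler_normc_sum (I : Type) (r : seq I) (f : I -> R[i]) :
  normc (\sum_(i <- r) f i) <= \sum_(i <- r) normc (f i).
Proof.
elim/big_rec2: _ => [|i y x _ xy]; first by rewrite normc0.
by rewrite (le_trans (normcD_le _ _))// lerD2l.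
Qed.

Context {I : Type} (F : set_system I) {FF : ProperFilter F}.

(** The norm of [R[i]] takes values in [R[i]], whose positive elements have zero imaginary part; the
    epsilons on the two sides are therefore the same. *)
Lemma cvg_normcP (f : I -> R[i]) (a : R[i]) :
  (f x : R[i]^o) @[x --> F] --> (a : R[i]^o) <->
  normc (f x - a) @[x --> F] --> (0 : R).
Proof.
have E x : `|0 - normc (f x - a)| = normc (a - f x).
  by rewrite sub0r normrN ger0_norm ?normc_ge0// -normcN opprB.
split=> [fa|fa].
  apply/cvgrPdist_le => e e0.
  have /cvgrPdist_le/(_ e%:C) := fa; rewrite ltcR => /(_ e0).
  apply: filterS => x; rewrite E.
  by rewrite -[`|_|]/((normc (a - f x))%:C) lecR.
apply/cvgrPdist_le => -[e e']; rewrite ltcE/= => /andP[/eqP-> e0].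
have /cvgrPdist_le/(_ e e0) := fa.
apply: filterS => x; rewrite E.
by rewrite -[`|_|]/((normc (a - f x))%:C) -[e +i* 0]/(e%:C) lecR.
Qed.

Lemma cvg_ReIm (f : I -> R[i]) (a : R[i]) :
  Re (f x) @[x --> F] --> Re a -> Im (f x) @[x --> F] --> Im a ->
  normc (f x - a) @[x --> F] --> (0 : R).
Proof.
move=> fR fI.
have h : (`|Re (f x) - Re a| + `|Im (f x) - Im a|) @[x --> F] --> (0 : R).
  rewrite -[X in _ --> X](addr0 0); apply: cvgD; exact/norm_cvg0P/subr_cvg0.
apply: (squeeze_cvgr _ (cvg_cst 0) h); apply: nearW => x.
rewrite normc_ge0/= (le_trans (normc_le_ReIm _))//.
by case: (f x) (a) => u v [u' v'].
Qed.

Lemma cvg_normc (f : I -> R[i]) (a : R[i]) :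
  normc (f x - a) @[x --> F] --> (0 : R) ->
  normc (f x) @[x --> F] --> normc a.
Proof.
move=> fa; apply/subr_cvg0/norm_cvg0P.
apply: (squeeze_cvgr _ (cvg_cst 0) fa); apply: nearW => x.
by rewrite normr_ge0/= ler_dist_normc.
Qed.

Lemma cvg_wsum_normc (rho : R) m n (f : I -> nat -> R[i]) (a : nat -> R[i]) :
  (forall i, normc (f x i - a i) @[x --> F] --> (0 : R)) ->
  \sum_(m <= i < n) rho ^+ i * normc (f x i) @[x --> F] -->
  \sum_(m <= i < n) rho ^+ i * normc (a i).
Proof.
move=> fa; apply: cvg_big => [|i _]; first by move=> x; exact: add_continuous.
by apply: cvgM; [exact: cvg_cst|exact: cvg_normc].
Qed.

End ComplexConvergence.

(** * Matrices as operators on weighted l^1 *)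

Section WeightedMatrices.
Context {R : realType} (rho : {posnum R}).
Local Open Scope complex_scope.
Import ComplexField.Normc.
Local Notation Re := complex.Re.
Local Notation Im := complex.Im.
Local Notation r := (rho%:num).
Implicit Types (A : nat -> nat -> R) (b : nat -> R) (v w : nat -> R[i]).

Lemma ell1_partial_le (v : ell1 rho) m n :
  \sum_(m <= i < n) r ^+ i * normc (v i) <= ell1_norm v.
Proof.
apply: (@le_trans _ _ (series (fun i => r ^+ i * normc (v i)) n)).
  have [mn|/ltnW nm] := leqP m n.
    rewrite /series /= (big_cat_nat (leq0n m) mn)/= lerDr.
    by apply: sumr_ge0 => i _; exact: ell1_term_ge0.
  by rewrite big_geq// sumr_ge0// => i _; exact: ell1_term_ge0.
apply: nondecreasing_cvgn_le; last exact: ell1P.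
by apply: nondecreasing_series => i _ _; exact: ell1_term_ge0.
Qed.

Lemma ell1_norm_ge0 (v : ell1 rho) : 0 <= ell1_norm v.
Proof. by have := ell1_partial_le v 0 0; rewrite big_geq. Qed.

Lemma ell1_norm_le (v : ell1 rho) M :
  (forall n, \sum_(0 <= i < n) r ^+ i * normc (v i) <= M) -> ell1_norm v <= M.
Proof. by move=> H; apply: limr_le; [exact: ell1P|exact: nearW]. Qed.

Lemma ell1_summable_le v M :
  (forall n, \sum_(0 <= i < n) r ^+ i * normc (v i) <= M) -> ell1_summable rho v.
Proof.
move=> H; apply: nondecreasing_is_cvgn.
  by apply: nondecreasing_series => i _ _; exact: ell1_term_ge0.
by exists M => _ [n _ <-]; exact: H.
Qed.

(** Unlike [represents], this speaks of bare sequences, so the image can be constructed first and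
    shown summable afterwards. *)
Definition mx_apply A v w : Prop := forall i,
  (series (fun j => (A i j)%:C * v j) : nat -> R[i]^o) @ \oo --> (w i : R[i]^o).

Section Bound.
Context (A : nat -> nat -> R) (b : nat -> R).
Hypotheses (Ab : colnorm_le r A b) (b_ge0 : forall k, 0 <= b k)
  (b_mono : forall k l, (k <= l)%N -> b l <= b k).

(* By triangularity the rows from [m] on only meet columns from [m] on. *)
Lemma colnorm_rows_ge m n j :
  \sum_(m <= i < n) r ^+ i * `|A i j| <= b m * r ^+ j.
Proof.
have [Aut An] := Ab.
have [jm|mj] := ltnP j m.
  rewrite big_nat_cond big1 ?mulr_ge0 ?exprn_ge0// => i /andP[/andP[mi _] _].
  by rewrite Aut ?normr0 ?mulr0// (leq_trans jm).
apply: (@le_trans _ _ (b j * r ^+ j)); last by rewrite ler_wpM2r ?exprn_ge0 ?b_mono.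
rewrite (le_trans _ (An n j))// -(big_mkord xpredT (fun i => r ^+ i * `|A i j|)).
have [mn|/ltnW nm] := leqP m n.
  rewrite (big_cat_nat (leq0n m) mn)/= lerDr.
  by apply: sumr_ge0 => i _; rewrite mulr_ge0 ?exprn_ge0.
by rewrite [leLHS]big_geq//; apply: sumr_ge0 => i _; rewrite mulr_ge0 ?exprn_ge0.
Qed.

(** Truncate the series at [N], exchange the finite sums, apply the column bound and let [N] grow.
    The case [m = 0] bounds the operator norm; general [m] gives the uniform tails for
    compactness. *)
Lemma mx_apply_rows_ge (v : ell1 rho) w m n : mx_apply A v w ->
  \sum_(m <= i < n) r ^+ i * normc (w i) <= b m * ell1_norm v.
Proof.
move=> Avw.
pose s N i : R[i] := series (fun j => (A i j)%:C * v j) N.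
have H i : normc (s N i - w i) @[N --> \oo] --> (0 : R).
  by apply/cvg_normcP; exact: Avw.
apply: (cvgr_to_le (cvg_wsum_normc (rho := r) (m := m) (n := n) H)).
apply: nearW => N.
rewrite /s {s H}.
apply: (@le_trans _ _ (\sum_(m <= i < n) \sum_(0 <= j < N)
    normc (v j) * (r ^+ i * `|A i j|))).
  apply: ler_sum => i _; rewrite /series/=.
  rewrite (le_trans (ler_wpM2l _ (ler_normc_sum _ _)))// mulr_sumr.
  by apply: ler_sum => j _; rewrite normcM normc_real [leLHS]mulrA [leLHS]mulrC.
rewrite exchange_big/=.
apply: (@le_trans _ _ (\sum_(0 <= j < N) b m * (r ^+ j * normc (v j)))).
  apply: ler_sum => j _; rewrite -mulr_sumr mulrC mulrA.
  by rewrite ler_wpM2r ?normc_ge0 ?colnorm_rows_ge.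
by rewrite -mulr_sumr ler_wpM2l// ell1_partial_le.
Qed.

Lemma cvg_complex_series (u : nat -> R[i]) : cvgn (series (fun k => normc (u k))) ->
  exists a : R[i], (series u : nat -> R[i]^o) @ \oo --> (a : R[i]^o).
Proof.
move=> cu.
have dominated (f : nat -> R) : (forall k, `|f k| <= normc (u k)) ->
    cvgn (series f).
  move=> fu; apply: normed_cvg.
  apply: (@series_le_cvg _ _ (fun k => normc (u k))) => [k|k|k|//].
  - exact: normr_ge0.
  - exact: normc_ge0.
  - exact: fu.
have cR : cvgn (series (fun k => Re (u k))).
  by apply: dominated => k; exact: ler_Re_normc.
have cI : cvgn (series (fun k => Im (u k))).
  by apply: dominated => k; exact: ler_Im_normc.
exists (limn (series (fun k => Re (u k))) +i* limn (series (fun k => Im (u k)))).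
have sR : (fun n => Re (series u n)) = series (fun k => Re (u k)).
  apply/funext => n; rewrite /series/=.
  by elim/big_rec2: _ => // i x y _ <-; case: (u i) (y) => ? ? [].
have sI : (fun n => Im (series u n)) = series (fun k => Im (u k)).
  apply/funext => n; rewrite /series/=.
  by elim/big_rec2: _ => // i x y _ <-; case: (u i) (y) => ? ? [].
apply/cvg_normcP; apply: cvg_ReIm.
  by rewrite sR.
by rewrite sI.
Qed.

(** The single-row case of [colnorm_rows_ge] gives |A_ij| <= b_i rho^(j-i), so each row series is
    dominated by a multiple of the norm series of [v]. *)
Lemma mx_apply_exists (v : ell1 rho) : exists w, mx_apply A v w.
Proof.
have /choice[w wP] : forall i, exists a : R[i],
    (series (fun j => (A i j)%:C * v j) : nat -> R[i]^o) @ \oo --> (a : R[i]^o).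
  move=> i; apply: cvg_complex_series.
  apply: (@series_le_cvg _ _ (fun j => b i / r ^+ i * (r ^+ j * normc (v j)))).
  - by move=> k; exact: normc_ge0.
  - by move=> k; rewrite mulr_ge0 ?ell1_term_ge0 ?divr_ge0 ?exprn_ge0.
  - move=> j; rewrite normcM normc_real mulrA ler_wpM2r ?normc_ge0//.
    rewrite mulrAC ler_pdivlMr ?exprn_gt0// mulrC.
    by have := colnorm_rows_ge i i.+1 j; rewrite big_nat1.
  - by apply: is_cvg_seriesZ; exact: ell1P.
by exists w.
Qed.

End Bound.

Lemma mx_apply_uniq A v w w' : mx_apply A v w -> mx_apply A v w' -> w = w'.
Proof.
by move=> h h'; apply/funext => i; apply: (cvg_unique _ (h i) (h' i)); exact: norm_hausdorff.
Qed.

Lemma mx_apply_linear A (a : R[i]) v v' w w' : mx_apply A v w ->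
  mx_apply A v' w' -> mx_apply A (a *: v + v') (a *: w + w').
Proof.
move=> h h' i.
have -> : (series (fun j => (A i j)%:C * (a *: v + v') j)%R : nat -> R[i]^o) =
   (fun n => a *: (series (fun j => (A i j)%:C * v j) n : R[i]^o)
             + (series (fun j => (A i j)%:C * v' j) n : R[i]^o)).
  apply/funext => n; rewrite /series/= scaler_sumr -big_split/=.
  by apply: eq_bigr => j _; rewrite mulrDr mulrCA.
by apply: cvgD => //; apply: cvgZ => //; exact: cvg_cst.
Qed.

Lemma mx_apply_sub A A' v w w' : mx_apply A v w -> mx_apply A' v w' ->
  mx_apply (fun i j => A i j - A' i j) v (w - w').
Proof.
move=> h h' i.
have -> : (series (fun j => (A i j - A' i j)%:C * v j)%R : nat -> R[i]^o) =
   (fun n => (series (fun j => (A i j)%:C * v j) n : R[i]^o)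
             - (series (fun j => (A' i j)%:C * v j) n : R[i]^o)).
  apply/funext => n; rewrite /series/= -sumrB.
  by apply: eq_bigr => j _; rewrite rmorphB mulrBl.
exact: cvgB.
Qed.

Section Operator.
Context (A : nat -> nat -> R) (b : nat -> R).
Hypotheses (Ab : colnorm_le r A b) (b_ge0 : forall k, 0 <= b k)
  (b_mono : forall k l, (k <= l)%N -> b l <= b k).

Lemma represents_exists : exists T : {linear ell1 rho -> ell1 rho}, represents A T.
Proof.
have /choice[f fP] : forall v : ell1 rho, exists w : ell1 rho, mx_apply A v w.
  move=> v; have [w Avw] := mx_apply_exists Ab b_ge0 b_mono v.
  have sw : w \in ell1_pred rho.
    rewrite inE; apply: ell1_summable_le => n.
    exact: (mx_apply_rows_ge Ab b_ge0 b_mono 0 n Avw).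
  by exists (Ell1 sw).
(* The images were chosen one by one; linearity follows from uniqueness of limits. *)
have flin : linear f.
  move=> a u v; apply: val_inj.
  have H : mx_apply A (a *: u + v : ell1 rho) (a *: f u + f v : ell1 rho).
    have valE (x y : ell1 rho) :
      ell1_seq (a *: x + y) = a *: ell1_seq x + ell1_seq y by [].
    by rewrite !valE; apply: mx_apply_linear; exact: fP.
  exact: mx_apply_uniq (fP _) H.
pose fL := GRing.isLinear.Build _ _ _ _ f flin.
pose T : {linear ell1 rho -> ell1 rho} := HB.pack f fL.
by exists T => v i; exact: fP.
Qed.

Lemma opnorm_le (f : ell1 rho -> ell1 rho) : (forall v : ell1 rho, mx_apply A v (f v)) ->
  (opnorm f <= (b 0%N)%:E)%E.
Proof.
move=> fP; apply: ge_ereal_sup => _ [v /= v1 <-]; rewrite lee_fin.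
apply: ell1_norm_le => n.
rewrite (le_trans (mx_apply_rows_ge Ab b_ge0 b_mono 0 n (fP v)))//.
by rewrite ler_piMr.
Qed.

Lemma mx_bounded_colnorm : mx_bounded rho A.
Proof.
have [T TA] := represents_exists; exists T; split=> //.
by rewrite (le_lt_trans (opnorm_le TA))// ltry.
Qed.

End Operator.

Lemma opnorm_ge0 (f : ell1 rho -> ell1 rho) : (0 <= opnorm f)%E.
Proof.
apply: le_trans (_ : ((ell1_norm (f 0))%:E <= _)%E).
  by rewrite lee_fin ell1_norm_ge0.
apply: ereal_sup_ubound.
exists 0 => //=; apply: ell1_norm_le => n.
by rewrite big1// => i _; rewrite normc0 mulr0.
Qed.

Lemma mx_cvg_opnorm_colnorm (A_ : nat -> nat -> nat -> R) A M (c : nat -> R) :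
  0 <= M -> (forall m, 0 <= c m) -> colnorm_le r A (fun=> M) ->
  (forall m, (0 < m)%N -> colnorm_le r (A_ m) (fun=> M)) ->
  (forall m, (0 < m)%N ->
    colnorm_le r (fun i j => A_ m i j - A i j) (fun=> c m)) ->
  c @ \oo --> (0 : R) -> mx_cvg_opnorm rho A_ A.
Proof.
move=> M0 c0 AM AmM Amc cc.
have [T TA] := represents_exists AM (fun=> M0) (fun _ _ _ => lexx _).
have /choice[T_ TAm] : forall m, exists T : {linear ell1 rho -> ell1 rho},
    (0 < m)%N -> represents (A_ m) T.
  (* Nothing is required at index 0, so any operator fills the place. *)
  case=> [|m]; first by exists T.
  have [Tm TAm] := represents_exists (AmM m.+1 isT) (fun=> M0) (fun _ _ _ => lexx _).
  by exists Tm.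
have fin A' (T' : {linear ell1 rho -> ell1 rho}) : colnorm_le r A' (fun=> M) ->
    represents A' T' -> (opnorm T' < +oo)%E.
  move=> A'M TA'; apply: le_lt_trans (ltry M).
  exact: (opnorm_le A'M (fun=> M0) (fun _ _ _ => lexx _) TA').
exists T_, T; split=> [m m0||].
- by split; [exact: TAm|apply: (fin (A_ m)); [exact: AmM|exact: TAm]].
- by split; [exact: TA|exact: (fin A)].
have cE : (c m)%:E @[m --> \oo] --> 0%E.
  by apply/fine_cvgP; split=> //; exact: nearW.
apply: (squeeze_cvge _ (cvg_cst 0%E) cE).
near=> m; rewrite opnorm_ge0/=.
have m0 : (0 < m)%N by near: m; exact: nbhs_infty_ge.
apply: (opnorm_le (Amc m m0) (fun=> c0 m) (fun _ _ _ => lexx _)) => v.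
exact: (mx_apply_sub (TAm m m0 v) (TA v)).
Unshelve. all: end_near. Qed.

End WeightedMatrices.

(** * Compactness from uniformly small tails *)

Section Compactness.
Context {R : realType} (rho : {posnum R}).
Local Open Scope complex_scope.
Import ComplexField.Normc.
Local Notation Re := complex.Re.
Local Notation Im := complex.Im.
Local Notation r := (rho%:num).

(** A compact segment provides a cluster point, and an ultrafilter converges to its cluster
    points. *)
Lemma cvg_ultra_bounded (I : Type) (F : set_system I) (f : I -> R) c :
  UltraFilter F -> F [set x | `|f x| <= c] -> exists p : R, f x @[x --> F] --> p.
Proof.
move=> UF Fc.
have Fseg : (f @ F) [set` `[- c, c]].
  rewrite /fmap/=; apply: filterS Fc => x /= fx.
  by rewrite in_itv/= -ler_norml.
have [p [_ pF]] := segment_compact _ Fseg.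
exists p => U pU; have [//|FU] := in_ultra_setVsetC (f @^-1` U) UF.
by have [y []] := pF (~` U) U FU pU.
Qed.

Lemma cvg_ultra_bounded_complex (I : Type) (F : set_system I) (f : I -> R[i]) c :
  UltraFilter F -> F [set x | normc (f x) <= c] ->
  exists a : R[i], normc (f x - a) @[x --> F] --> (0 : R).
Proof.
move=> UF Fc.
have /cvg_ultra_bounded[x xP] : F [set x | `|Re (f x)| <= c].
  by apply: filterS Fc => x /=; apply: le_trans; exact: ler_Re_normc.
have /cvg_ultra_bounded[y yP] : F [set x | `|Im (f x)| <= c].
  by apply: filterS Fc => z /=; apply: le_trans; exact: ler_Im_normc.
by exists (x +i* y); exact: cvg_ReIm.
Qed.

(** Along an ultrafilter each coordinate is bounded, hence converges. The tail bounds concern finite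
    sums and pass to the limit [g]; with tails uniformly small, convergence of finitely many
    coordinates gives convergence in norm. *)
Lemma compact_tail_le (d : nat -> R) : d @ \oo --> (0 : R) ->
  compact [set w : ell1 rho |
    forall m n, \sum_(m <= i < n) r ^+ i * normc (w i) <= d m].
Proof.
move=> d0; rewrite compact_ultra => F UF FK.
have /choice[g gP] : forall i, exists a : R[i],
    normc ((w : ell1 rho) i - a) @[w --> F] --> (0 : R).
  move=> i; apply: (@cvg_ultra_bounded_complex _ _ _ (d i / r ^+ i)).
  apply: filterS FK => w /(_ i i.+1); rewrite big_nat1 /=.
  by rewrite ler_pdivlMr ?exprn_gt0// mulrC.
have gK m n : \sum_(m <= i < n) r ^+ i * normc (g i) <= d m.
  apply: (cvgr_to_le (cvg_wsum_normc (rho := r) (m := m) (n := n) gP)).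
  by apply: filterS FK => w /=.
have sg : g \in ell1_pred rho.
  by rewrite inE; apply: (@ell1_summable_le _ _ _ (d 0%N)) => n.
exists (Ell1 sg); split=> //=.
suff : (w : ell1 rho) @[w --> F] --> Ell1 sg by [].
apply/cvgrPdist_le => -[e e']; rewrite ltcE/= => /andP[/eqP-> e0].
(* Beyond [N] the tails of [w] and [g] take e/4 each, which leaves e/2 for the head. *)
have e4 : 0 < e / 4 by rewrite divr_gt0.
have [N _ /(_ N (leqnn _)) dN] : \forall m \near \oo, d m <= e / 4.
  by move/cvgr_le: d0; exact.
have head : \sum_(0 <= i < N) r ^+ i * normc ((w : ell1 rho) i - g i)
    @[w --> F] --> (0 : R).
  rewrite [X in _ --> X](_ : 0 = \sum_(0 <= i < N) r ^+ i * normc (0 : R[i])).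
    apply: (cvg_wsum_normc (a := fun=> 0)) => i.
    by under eq_fun do rewrite subr0; exact: gP.
  by rewrite big1// => i _; rewrite normc0 mulr0.
have e2 : 0 < e / 2 by rewrite divr_gt0.
have := head => /cvgr_le/(_ _ e2); apply: filterS2 FK => w /= wK wN.
rewrite -[`|_|]/((ell1_norm (Ell1 sg - w))%:C) -[e +i* 0]/(e%:C) lecR.
apply: ell1_norm_le => n.
have term i : r ^+ i * normc ((Ell1 sg - w) i) = r ^+ i * normc (w i - g i).
  by rewrite -normcN; congr (_ * normc _); exact: opprB.
under eq_bigr do rewrite term.
have t0 i : 0 <= r ^+ i * normc (w i - g i) by rewrite mulr_ge0 ?exprn_ge0 ?normc_ge0.
apply: (@le_trans _ _ (\sum_(0 <= i < N) r ^+ i * normc (w i - g i) +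
    \sum_(N <= i < n) r ^+ i * normc (w i - g i))).
  have [Nn|/ltnW nN] := leqP N n; first by rewrite -big_cat_nat.
  rewrite [X in _ + X]big_geq// addr0 [leRHS](big_cat_nat (leq0n n) nN)/=.
  by rewrite lerDl sumr_ge0.
have -> : e = e / 2 + (e / 4 + e / 4) by field.
apply: lerD wN _.
apply: (@le_trans _ _ (d N + d N)); last by apply: lerD; exact: dN.
apply: le_trans (lerD (wK N n) (gK N n)); rewrite -big_split/=.
apply: ler_sum => i _; rewrite -mulrDr ler_wpM2l ?exprn_ge0//.
by rewrite (le_trans (normcD_le _ _))// normcN.
Qed.

(** By [mx_apply_rows_ge] the image of the ball of radius [M] has tails at most [b m * M], so it
    lies in a compact set from [compact_tail_le]. *)
Lemma mx_compact_colnorm (A : nat -> nat -> R) (b : nat -> R) :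
  colnorm_le r A b -> (forall k, 0 <= b k) ->
  (forall k l, (k <= l)%N -> b l <= b k) -> b @ \oo --> (0 : R) ->
  mx_compact rho A.
Proof.
move=> Ab b_ge0 b_mono b0.
have [T TA] := represents_exists Ab b_ge0 b_mono.
exists T; split=> // B /pinfty_ex_gt0[[M M']]; rewrite ltcE/=.
move=> /andP[/eqP-> M0] BM.
have d0 : (fun m => b m * M) @ \oo --> (0 : R).
  by rewrite -[X in _ --> X](mul0r M); apply: cvgM => //; exact: cvg_cst.
apply: precompact_subset (compact_precompact _ (compact_tail_le d0)); last first.
  exact: norm_hausdorff.
move=> _ [v Bv <-] m n /=.
rewrite (le_trans (mx_apply_rows_ge Ab b_ge0 b_mono m n (TA v)))//.
by rewrite ler_wpM2l// -lecR; exact: BM.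
Qed.

End Compactness.

(** * A common majorant for all approximations, and the conclusion *)

Lemma cvg_series_pred (R : realType) (u : nat -> R) :
  cvgn (series u) -> cvgn (series (fun k => u k.-1)).
Proof.
move=> cu; have : cvgn (fun n => u 0%N + series u n).
  by apply: is_cvgD => //; exact: is_cvg_cst.
have -> : (fun n => u 0%N + series u n) =
    [sequence series (fun k => u k.-1) n.+1]_n.
  by apply/funext => n; rewrite /series/= big_nat_recl.
by move/cvg_ex => [l]; rewrite cvg_shiftS => ul; apply/cvg_ex; exists l.
Qed.

(** The sequence [om] is chosen before [J], from [B], [del] and [rho] alone; this uniformity yields
    the convergence statements. *)
Lemma incr_le_perturbation (R : realType) (B rho : R) (del : nat -> R) :
  0 <= B -> (forall k, 0 <= del k) -> cvgn (series del) -> 1 < rho ->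
  exists om : nat -> R, [/\ forall k, 0 <= om k, cvgn (series om)
    & forall J, perturbation_le B del J -> incr_le rho^-1 om (diag_col J)].
Proof.
move=> B0 d0 cd rho1; have rho0 : 0 < rho := lt_trans ltr01 rho1.
pose e k := 2 * B * (del k + del k.-1).
have e0 k : 0 <= e k by rewrite !mulr_ge0 ?addr_ge0.
have ce : cvgn (series e).
  have -> : e = (2 * B) *: (del + (fun k => del k.-1)) by [].
  by apply: is_cvg_seriesZ; exact: (is_cvg_seriesD cd (cvg_series_pred cd)).
have q01 : 0 <= rho^-1 < 1 by rewrite invr_ge0 ltW//= invf_lt1.
exists (incr_bound rho^-1 e); split=> [k||J JP n k].
- by have [] := majorant_ge0 k (andP q01).1 e0.
- exact: cvg_incr_bound.
- apply: diag_col_increment_le JP; case/andP: q01 => -> /ltW; exact.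
Qed.

Theorem theorem5p11 (R : realType) (J : nat -> nat -> R)
    (J_jacobi : jacobi J) (J_trace : trace_class_perturbation J) :
  let C := connection J free_jacobi in
  let C_ m := connection (finite_rank_approx m J) free_jacobi in
  [/\ diag_limits_exist C,
      forall m, (0 < m)%N -> diag_limits_exist (C_ m),
      [/\ forall i j, C i j = toeplitz_part C i j + com_part C i j,
          upper_triangular (toeplitz_part C)
        & toeplitz (toeplitz_part C)]
    & forall rho : {posnum R}, 1 < rho%:num ->
      [/\ mx_bounded rho (toeplitz_part C) /\ mx_compact rho (com_part C),
          forall m, (0 < m)%N -> mx_bounded rho (toeplitz_part (C_ m)) /\
                                 mx_compact rho (com_part (C_ m)),
          mx_cvg_opnorm rho C_ C,
          mx_cvg_opnorm rho (fun m => toeplitz_part (C_ m)) (toeplitz_part C)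
        & mx_cvg_opnorm rho (fun m => com_part (C_ m)) (com_part C)]].
Proof.
move=> C C_.
have J0 := jacobi_offdiag_gt0 J_jacobi.
have [B [B1 JP]] := perturbation_le_jacobi J0 J_trace.
set del := (fun k => _) in JP.
have JmP m : perturbation_le B del (finite_rank_approx m J).
  exact: perturbation_le_finite_rank_approx.
have Jm0 m k : 0 < finite_rank_approx m J k k.+1 by have [] := JmP m k.
have del0 k : 0 <= del k by rewrite addr_ge0.
have B0 : 0 <= B := le_trans ler01 B1.
have incr (rho : R) := @incr_le_perturbation R B rho del B0 del0 J_trace.
(* The existence of the diagonal limits does not involve [rho]; any weight above 1 gives it, here
   2. *)
have half1 : 1 < 2 :> R by rewrite ltr1n.
have [om2 [om20 com2 H2]] := incr _ half1.
split=> [|m m0||rho rho1].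
- exact: (diag_limits_exist_connection (ltr0n _ 2) om20 com2 J0 (H2 _ JP)).
- exact: (diag_limits_exist_connection (ltr0n _ 2) om20 com2 (Jm0 m) (H2 _ (JmP m))).
- split=> [i j||]; first by rewrite /com_part addrC subrK.
    exact: toeplitz_part_upper_triangular.
  exact: toeplitz_toeplitz_part.
have rho0 : 0 < rho%:num by [].
have [om [om0 com /[dup] /(_ _ JP) JI /(_ _ (JmP _)) JmI]] := incr _ rho1.
pose w := series_tail om.
have w0 k : 0 <= w k by exact: series_tail_ge0.
have w_mono k l : (k <= l)%N -> w l <= w k by exact: series_tail_nonincreasing.
have cw : w @ \oo --> (0 : R) by exact: cvg_series_tail.
have cstw (c : R) : (fun m => c * w m) @ \oo --> (0 : R).
  by rewrite -[X in _ --> X](mulr0 c); apply: cvgM cw; exact: cvg_cst.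
have agree m k : (k <= m)%N -> diag_col (finite_rank_approx m J) k = diag_col J k.
  exact: diag_col_finite_rank_approx.
(* An arbitrary [J'] is taken so as to serve both [J] and its approximations. *)
have parts J' : (forall k, 0 < J' k k.+1) ->
    incr_le rho%:num^-1 om (diag_col J') ->
    mx_bounded rho (toeplitz_part (connection J' free_jacobi)) /\
    mx_compact rho (com_part (connection J' free_jacobi)).
  move=> J'0 J'I; split.
    apply: (mx_bounded_colnorm (colnorm_toeplitz_part rho0 om0 com J'0 J'I)) => //.
  apply: (mx_compact_colnorm (colnorm_com_part rho0 om0 com J'0 J'I)) => //.
    by move=> k l kl; exact: w_mono.
  by rewrite (cvg_shiftS w).
(* [mx_cvg_opnorm_colnorm] asks for a bound independent of the column, so [w j.+1] is weakened to
   [w 0%N]. *)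
have com_le J' : (forall k, 0 < J' k k.+1) ->
    incr_le rho%:num^-1 om (diag_col J') ->
    colnorm_le rho%:num (com_part (connection J' free_jacobi)) (fun=> w 0%N).
  move=> J'0 J'I; have [h1 h2] := colnorm_com_part rho0 om0 com J'0 J'I.
  split=> // n j; rewrite (le_trans (h2 n j))// ler_wpM2r ?exprn_ge0//.
  exact: w_mono.
split=> [|m _|||].
- exact: parts.
- exact: parts.
- apply: (@mx_cvg_opnorm_colnorm _ _ _ _ (w 0%N) (fun m => 2 * w m)) => //.
  + by move=> m; rewrite mulr_ge0.
  + exact: colnorm_connection.
  + by move=> m _; exact: colnorm_connection.
  + move=> m _; exact: (colnorm_connection_sub rho0 om0 com J0 (Jm0 m) JI (JmI m) (agree m)).
- apply: (@mx_cvg_opnorm_colnorm _ _ _ _ (w 0%N) (fun m => 2 * w m)) => //.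
  + by move=> m; rewrite mulr_ge0.
  + exact: colnorm_toeplitz_part.
  + by move=> m _; exact: colnorm_toeplitz_part.
  + move=> m _; exact: (colnorm_toeplitz_part_sub rho0 om0 com J0 (Jm0 m) JI (JmI m) (agree m)).
- apply: (@mx_cvg_opnorm_colnorm _ _ _ _ (w 0%N) (fun m => 4 * w m)) => //.
  + by move=> m; rewrite mulr_ge0.
  + exact: com_le.
  + by move=> m _; exact: com_le.
  + move=> m _; exact: (colnorm_com_part_sub rho0 om0 com J0 (Jm0 m) JI (JmI m) (agree m)).
Qed.
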